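(* Let $\lambda$ be an infinite cardinal with $\lambda^{\aleph_0}=\lambda$, and let $G$ be a graph with $|G|=\mathrm{Chr}(G)=\lambda^+$ (i.e. $G$ has $\lambda^+$ vertices and chromatic number $\lambda^+$). Then there exist an integer $n\ge 1$ and a function $e:\{1,\dots,2n\}\to\{0,1\}$ with $|e^{-1}(0)|=n$ such that for every $H\in\mathcal K^{n,e}$ the associated graph of $H$ is isomorphic to a (not necessarily induced) subgraph of $G$.
   Context: Fix an integer $n\ge1$ and a function $e:\{1,\dots,2n\}\to\{0,1\}$ with $|e^{-1}(0)|=n$ (so $|e^{-1}(1)|=n$). Enumerate $e^{-1}(0)=\{a_1<\dots<a_n\}$ and $e^{-1}(1)=\{b_1<\dots<b_n\}$. A structure is a tuple $H=(V,<,U,X,h_1,\dots,h_n)$ where $(V,<)$ is a finite linearly ordered set, $U\subseteq V$, $X$ is a set of $2$-element subsets of $U$ (a graph on $U$), and $h_1,\dots,h_n:U\to V$ satisfy $h_1(x)<\dots<h_n(x)=x$ for all $x\in U$. An isomorphism of structures is an order-preserving bijection preserving $U$, $X$ and each $h_i$. The associated graph of $H$ is the graph $(U,X)$. For $S\subseteq V$ closed under the $h_i$ on $U\cap S$, the restriction of $H$ to $S$ is $(S,<,U\cap S,X\cap[S]^2,h_1|_{U\cap S},\dots,h_n|_{U\cap S})$. $\mathcal K_0$ consists of all structures isomorphic to $(\{1,\dots,n\},<,\{n\},\emptyset,h_1,\dots,h_n)$ with $<$ the natural order and $h_i(n)=i$. Edgeless amalgamation: for a structure $H$ and $x\in V$,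 a structure $H'=(V',<',U',X',h'_1,\dots,h'_n)$ is called $H+_xH$ if $V'=W\cup V_0\cup V_1$ with $W<'V_0<'V_1$ (every element of $W$ precedes every element of $V_0$, which precede every element of $V_1$), for each $i\in\{0,1\}$ there is an isomorphism from $H$ onto the restriction of $H'$ to $W\cup V_i$ sending $x$ to $\min(V_i)$, and $U'$, $X'$ are the unions of the corresponding parts of these two restrictions (so there are no edges between $V_0$ and $V_1$). One-edge amalgamation: for a structure $H$ and $y\in U$, a structure $H'=(V',<',U',X',h'_1,\dots,h'_n)$ is called $H*_yH$ if $V'=V_0\cup V_1\cup\dots\cup V_{2n}$ with $V_0<'V_1<'\dots<'V_{2n}$, for each $\varepsilon\in\{0,1\}$ there is an isomorphism $\iota_\varepsilon$ from $H$ onto the restriction of $H'$ to $V_0\cup\bigcup\{V_j:e(j)=\varepsilon\}$, and, writing $x_\varepsilon=\iota_\varepsilon(y)$, we have $h'_i(x_0)=\min(V_{a_i})$ and $h'_i(x_1)=\min(V_{b_i})$ for $1\le i\le n$; $U'$ is the union of the two copies of $U$, and $X'$ is the union of the two copies of $X$ together with the single extra edge $\{x_0,x_1\}$. $\mathcal K_{t+1}$ is the class of all structures of the form $H+_xH$ with $H\in\mathcal K_t$, $x\in V_H$, or $H*_yH$ with $H\in\mathcal K_t$, $y\in U_H$. Finally $\mathcal K^{n,e}=\bigcup_{t<\omega}\mathcal K_t$. *)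

(* Defs.v *)
From mathcomp Require Import all_boot.
Unset Printing Implicit Defensive.

Definition card_le (A B : Type) : Prop := exists f : A -> B, injective f.
Definition card_eq (A B : Type) : Prop := exists f : A -> B, bijective f.
Definition card_lt (A B : Type) : Prop := card_le A B /\ ~ card_le B A.
Definition is_succ_card (L K : Type) : Prop :=
  card_lt L K /\ forall T : Type, card_lt L T -> card_le K T.

Definition simple_graph {V : Type} (E : V -> V -> Prop) : Prop :=
  (forall u v, E u v -> E v u) /\ (forall v, ~ E v v).
Definition colorable {V : Type} (E : V -> V -> Prop) (C : Type) : Prop :=
  exists c : V -> C, forall u v, E u v -> c u <> c v.
Definition chromatic_number_is {V : Type} (E : V -> V -> Prop) (K : Type) : Prop :=
  colorable E K /\ forall C : Type, card_lt C K -> ~ colorable E C.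

(* A finite linear order is represented canonically by 'I_sz with its natural
   order.  h i is h_i (only i in 1..n is meaningful; h_i is only meaningful on U).
   X is a set of (2-element) subsets. *)
Record structure := Struct {
  sz : nat;
  sU : {set 'I_sz};
  sX : {set {set 'I_sz}};
  sh : nat -> 'I_sz -> 'I_sz }.

Definition wf_struct (n : nat) (H : structure) : Prop :=
  (forall S, S \in sX H -> #|S| = 2 /\ S \subset sU H) /\
  (forall x, x \in sU H ->
     (forall i, 1 <= i -> i < n -> sh H i x < sh H i.+1 x) /\ sh H n x = x).

Definition emb (n : nat) (H H' : structure) (f : 'I_(sz H) -> 'I_(sz H'))
    (S : {set 'I_(sz H')}) : Prop :=
  (forall x y : 'I_(sz H), x < y -> f x < f y) /\
  (forall v, v \in S <-> exists x, f x = v) /\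
  (forall x, (f x \in sU H') = (x \in sU H)) /\
  (forall x y, ([set f x; f y] \in sX H') = ([set x; y] \in sX H)) /\
  (forall x i, x \in sU H -> 1 <= i <= n -> f (sh H i x) = sh H' i (f x)).

Definition iso_struct (n : nat) (H H' : structure) : Prop :=
  exists f, emb n H H' f setT.

(* the structure ({1..n}, <, {n}, empty, h_i(n) = i), on 'I_n (k <-> k+1) *)
Definition base_struct (n : nat) : structure :=
  @Struct n [set x : 'I_n | val x == n.-1] set0 (fun i x => insubd x i.-1).

Definition is_min {m : nat} (v : 'I_m) (A : {set 'I_m}) : Prop :=
  v \in A /\ forall w, w \in A -> v <= w.

(* H' is H +_x H ; blocks: blk v = 0 for W, 1 for V_0, 2 for V_1 *)
Definition is_plus (n : nat) (H : structure) (x : 'I_(sz H)) (H' : structure) : Prop :=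
  wf_struct n H' /\
  exists blk : 'I_(sz H') -> nat,
    (forall v, blk v <= 2) /\
    (forall u v, blk u < blk v -> u < v) /\
    let WV0 := [set v | blk v != 2] in
    let WV1 := [set v | blk v != 1] in
    exists f0 f1,
      emb n H H' f0 WV0 /\ emb n H H' f1 WV1 /\
      is_min (f0 x) [set v | blk v == 1] /\
      is_min (f1 x) [set v | blk v == 2] /\
      (forall S, S \in sX H' -> S \subset WV0 \/ S \subset WV1).

(* e : nat -> bool encodes e : {1..2n} -> {0,1}, with e j = true meaning e(j) = 1 *)
Definition a_idx (n : nat) (e : nat -> bool) (i : nat) : nat :=
  nth 0 [seq j <- iota 1 (2 * n) | ~~ e j] i.-1.
Definition b_idx (n : nat) (e : nat -> bool) (i : nat) : nat :=
  nth 0 [seq j <- iota 1 (2 * n) | e j] i.-1.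

(* H' is H *_y H ; blocks: blk v = j for v in V_j, 0 <= j <= 2n *)
Definition is_star (n : nat) (e : nat -> bool) (H : structure) (y : 'I_(sz H))
    (H' : structure) : Prop :=
  wf_struct n H' /\
  exists blk : 'I_(sz H') -> nat,
    (forall v, blk v <= 2 * n) /\
    (forall u v, blk u < blk v -> u < v) /\
    let Vb (j : nat) := [set v | blk v == j] in
    let S (eps : bool) := [set v | (blk v == 0) || ((1 <= blk v) && (e (blk v) == eps))] in
    exists f0 f1,
      emb n H H' f0 (S false) /\ emb n H H' f1 (S true) /\
      (forall i, 1 <= i <= n ->
         is_min (sh H' i (f0 y)) (Vb (a_idx n e i)) /\
         is_min (sh H' i (f1 y)) (Vb (b_idx n e i))) /\
      [set f0 y; f1 y] \in sX H' /\
      (forall T, T \in sX H' ->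
         T \subset S false \/ T \subset S true \/ T = [set f0 y; f1 y]).

(* K^{n,e} = union of the K_t *)
Inductive inK (n : nat) (e : nat -> bool) : structure -> Prop :=
  | inK0 H : iso_struct n (base_struct n) H -> inK n e H
  | inKplus H x H' : inK n e H -> is_plus n H x H' -> inK n e H'
  | inKstar H y H' : inK n e H -> y \in sU H -> is_star n e H y H' -> inK n e H'.

Definition graph_embeds (H : structure) {V : Type} (E : V -> V -> Prop) : Prop :=
  exists g : 'I_(sz H) -> V,
    {in sU H &, injective g} /\
    (forall x y, [set x; y] \in sX H -> E (g x) (g y)).

(* Main.v *)
(* Idea. Well-order V in type lambda^+. Attach to each vertex x a countable set
   F(x) of points of V, closed under countably many functions (the terms of
   generic_pattern). There is a colouring with lambda^aleph_0 = lambda colours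
   such that for adjacent x, y of the same colour, F(x) and F(y) share an initial
   segment, are disjoint above it, and have no common limit there; hence they
   alternate only finitely often above it. The starts of the alternating blocks
   give h_1 < ... < h_n and the pattern e. If every such (n, e, h) could be
   destroyed by adding countably many functions and colours, then closing off all
   of these would yield a proper colouring of G with lambda colours. So some
   (n, e, h) survives every such addition.

   For this (n, e, h) the sets that contain no surviving edge form an ideal, normal
   with respect to h_1. By induction on the generation of H in K^{n,e}, every
   conull set of vertices realizes H at positions in any prescribed club. Edgeless
   amalgamation holds because positions in a smaller club can be moved up
   unboundedly. For the one-edge amalgamation let A be the set of vertices playing
   the role of y over fixed values below h_1(y): by normality A is positive, and
   adding the chosen realizations to the family F yields an edge inside A whose
   two realizations interleave exactly as e prescribes. *)
Require Import Defs.
From mathcomp Require Import all_boot.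
From mathcomp Require Import boolp wochoice.
Set Implicit Arguments.
Unset Strict Implicit.
Unset Printing Implicit Defensive.

(** * Well-orders and cardinal arithmetic *)

Record strict_wo (T : Type) (lt : T -> T -> Prop) : Prop := StrictWo {
  wo_wf : well_founded lt;
  wo_trans : forall x y z, lt x y -> lt y z -> lt x z;
  wo_total : forall x y, x = y \/ lt x y \/ lt y x }.

Lemma strict_wo_exists (T : Type) : exists lt : T -> T -> Prop, strict_wo lt.
Proof.
have [R woR] := well_ordering_principle {classic T}.
have woR' : wo_chain R predT by move=> A _; exact: woR.
have anti : antisymmetric R.
  by move=> x y; exact: (wo_chain_antisymmetric woR').
have tot : total R by move=> x y; exact: (wo_chainW woR').
have trR : transitive R.
  move=> y x z Rxy Ryz.
  (* Transitivity comes from the least element of the three. *)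
  have [|m [[mA mlb] _]] := woR (mem [:: x; y; z]); first by exists x; rewrite !inE eqxx.
  have mx : R m x by apply: mlb; rewrite !inE eqxx.
  have my : R m y by apply: mlb; rewrite !inE eqxx orbT.
  have mz : R m z by apply: mlb; rewrite !inE eqxx !orbT.
  move: mA; rewrite !inE => /or3P[]/eqP em; subst m => //.
    by rewrite (anti x y) // Rxy.
  by rewrite -(anti y z) // Ryz.
exists (fun x y => ~~ R y x); split.
- move=> x; apply: contrapT => nx.
  have [|m [[mA mlb] _]] := woR [pred x | `[< ~ Acc (fun x y => ~~ R y x) x >]].
    by exists x; rewrite inE; apply/asboolP.
  move: mA; rewrite inE => /asboolP; apply; split=> y nRmy.
  by apply: contrapT => ny; move/negP: nRmy; apply; apply: mlb; rewrite inE; apply/asboolP.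
- move=> x y z nyx nzy; apply/negP => Rzx.
  have Rxy : R x y by case/orP: (tot x y) => // Ryx; rewrite Ryx in nyx.
  by rewrite (trR _ _ _ Rzx Rxy) in nzy.
- move=> x y; case: (boolP (R x y)) => Rxy; last by right; right.
  case: (boolP (R y x)) => Ryx; last by right; left.
  by left; apply: anti; rewrite Rxy.
Qed.

Lemma card_le_trans (A B C : Type) : card_le A B -> card_le B C -> card_le A C.
Proof. by move=> [f fi] [g gi]; exists (g \o f); exact: inj_comp. Qed.


Lemma sval_inj_prop (T : Type) (P : T -> Prop) : injective (@sval T P).
Proof.
move=> [a pa] [b pb] /= e; subst b; congr exist; exact: Prop_irrelevance.
Qed.

Section Card.
Variable L : Type.
Hypothesis infL : card_le nat L.
Hypothesis powL : card_eq (nat -> L) L.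

Lemma card_le_seqfun : card_le (nat -> L) L.
Proof. by have [f fb] := powL; exists f; exact: bij_inj. Qed.

(** Sequences absorb the sum: coordinate 0 carries the element, the later ones name the summand. *)
Lemma card_le_sum : card_le (L + L) L.
Proof.
have [i ii] := infL; apply: card_le_trans card_le_seqfun.
exists (fun s k => match s with inl l => if k is 0 then l else i 0
                   | inr l => if k is 0 then l else i 1 end).
move=> [l|l] [l'|l'] E; have E0 := congr1 (@^~ 0) E; have E1 := congr1 (@^~ 1) E.
- by rewrite /= in E0; rewrite E0.
- by move/ii: E1.
- by move/ii: E1.
- by rewrite /= in E0; rewrite E0.
Qed.

Lemma card_lt_powerset : card_lt L (L -> bool).
Proof.
split.
  exists (fun l l' => `[< l = l' >]) => l l' /(congr1 (@^~ l')) /=.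
  by rewrite (asboolT (erefl l')) => /asboolP.
move=> [f fi].
(* Cantor's diagonal set for an injection of the subsets of L into L. *)
pose D l := `[< exists A, f A = l /\ ~~ A l >].
case: (boolP (D (f D))) => DD.
  by have /asboolP[A [/fi AD]] := DD; rewrite AD DD.
by case/negP: (DD); apply/asboolP; exists D.
Qed.

Variable V : Type.
Hypothesis succV : is_succ_card L V.

(** If some initial segment of an arbitrary well-order of V does not inject into L, take the first
    such. L followed by this segment has more than lambda elements, so V injects into it; its proper
    initial segments are small, and the order is pulled back to V. *)
Lemma succ_card_wo : exists lt : V -> V -> Prop, strict_wo lt /\
  forall b, exists c : V -> L, forall x y, lt x b -> lt y b -> c x = c y -> x = y.
Proof.
have [lV woV] := strict_wo_exists V; have [lL woL] := strict_wo_exists L.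
pose small b := exists c : V -> L, forall x y, lV x b -> lV y b -> c x = c y -> x = y.
have [sm|/existsNP[b0 nb0]] := pselect (forall b, small b); first by exists lV.
have [b [nb bmin]] : exists b, ~ small b /\ forall x, lV x b -> small x.
  elim/(well_founded_ind (wo_wf woV)): b0 nb0 => b IH nb.
  have [h|/existsNP[x /not_implyP[xb nx]]] := pselect (forall x, lV x b -> small x).
    by exists b.
  exact: IH x xb nx.
have [|j ji] := succV.2 (L + {x | lV x b})%type.
  split; first by exists inl => x y [].
  move=> [f fi]; apply: nb; have [g gi] := infL.
  exists (fun x => match pselect (lV x b) with left h => f (inr (exist _ x h)) | right _ => g 0 end).
  move=> x y xb yb; case: pselect => // hx; case: pselect => // hy /fi E.
  by case: E.
pose lt x y := match j x, j y with
  | inl a, inl b => lL a b | inl _, inr _ => True | inr _, inl _ => False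
  | inr a, inr b => lV (sval a) (sval b) end.
exists lt; split; first split.
- have accL l : forall x, j x = inl l -> Acc lt x.
    elim/(well_founded_ind (wo_wf woL)): l => l IH x jx; split=> y.
    move=> yx; have : lt y x by []; rewrite {1}/lt jx.
    by case jy: (j y) => [a|] al; [exact: (IH a al y jy) | case: al].
  have accV v : forall x w, j x = inr w -> sval w = v -> Acc lt x.
    elim/(well_founded_ind (wo_wf woV)): v => v IH x w jx wv; split=> y.
    move=> yx; have : lt y x by []; rewrite {1}/lt jx.
    case jy: (j y) => [a|a] al; first exact: (accL a y jy).
    by apply: (IH (sval a) _ y a jy erefl); rewrite -wv.
  by move=> x; case jx: (j x) => [a|a]; [exact: (accL a x jx) | exact: (accV _ x a jx erefl)].
- move=> x y z; rewrite /lt; case: (j x) (j y) (j z) => [a|a] [c|c] [d|d] //.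
    exact: wo_trans.
  exact: wo_trans.
- move=> x y; rewrite /lt; case jx: (j x) => [a|a]; case jy: (j y) => [c|c]; try by tauto.
    by have [e|[]] := wo_total woL a c; try tauto; left; apply: ji; rewrite jx jy e.
  have [e|[]] := wo_total woV (sval a) (sval c); try tauto; left; apply: ji; rewrite jx jy.
  by congr inr; exact: sval_inj_prop.
move=> x; case jx: (j x) => [a|a].
  have [g gi] := infL.
  exists (fun y => match j y with inl l => l | inr _ => g 0 end) => y z.
  rewrite /lt jx; case jy: (j y) => [u|u] //; case jz: (j z) => [v|v] // _ _ E.
  by apply: ji; rewrite jy jz E.
have [c cinj] := bmin _ (svalP a); have [s si] := card_le_sum.
exists (fun y => match j y with inl l => s (inl l) | inr v => s (inr (c (sval v))) end) => y z.
rewrite /lt jx; case jy: (j y) => [u|u]; case jz: (j z) => [v|v] uv vv /si E //.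
  by apply: ji; rewrite jy jz; case: E => ->.
case: E => E; have e := cinj _ _ uv vv E; apply: ji; rewrite jy jz.
by congr inr; exact: sval_inj_prop.
Qed.

End Card.

(** * Orders of type lambda^+ *)

Lemma exists_fun (A B : Type) (P : A -> B -> Prop) :
  (forall a, exists b, P a b) -> exists f : A -> B, forall a, P a (f a).
Proof. by move=> /choice[f fP]; exists f. Qed.

Section SuccessorCardinal.
Variables (L V : Type) (lt : V -> V -> Prop).
Hypothesis infL : card_le nat L.
Hypothesis powL : card_eq (nat -> L) L.
Hypothesis VL : ~ card_le V L.
Hypothesis wolt : strict_wo lt.
Hypothesis small : forall b, exists c : V -> L,
  forall x y, lt x b -> lt y b -> c x = c y -> x = y.

Lemma lt_min (P : V -> Prop) x : P x -> exists m, P m /\ forall y, P y -> ~ lt y m.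
Proof.
elim/(well_founded_ind (wo_wf wolt)): x => x IH Px.
have [h|/existsNP[y /not_implyP[Py /contrapT yx]]] := pselect (forall y, P y -> ~ lt y x).
  by exists x.
exact: IH y yx Py.
Qed.

Lemma lt_irr x : ~ lt x x.
Proof.
by elim/(well_founded_ind (wo_wf wolt)): x => x IH xx; exact: (IH x xx xx).
Qed.

Lemma lt_trans x y z : lt x y -> lt y z -> lt x z.
Proof. exact: (wo_trans wolt). Qed.

Lemma lt_asym x y : lt x y -> ~ lt y x.
Proof. by move=> xy yx; exact: lt_irr (lt_trans xy yx). Qed.

Lemma ltNlt x y z : ~ lt y x -> lt y z -> lt x z.
Proof. by move=> nyx yz; have [->|[xy|//]] := wo_total wolt x y => //; exact: lt_trans xy yz. Qed.

Lemma lt_Nlt x y z : lt x y -> ~ lt z y -> lt x z.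
Proof. by move=> xy nzy; have [<-|[yz|//]] := wo_total wolt y z => //; exact: lt_trans xy yz. Qed.

Lemma Nlt_eq x y : ~ lt x y -> ~ lt y x -> x = y.
Proof. by have [|[]] := wo_total wolt x y. Qed.

(** Regularity of lambda^+. If the values were unbounded, every b would be at most some G (k b), and
    b could be recovered from the code of k b, a bit telling whether b is G (k b), and the code of b
    among the points below G (k b). So V would inject into the sequences from L. *)
Lemma bounded_small (K : Type) (P : K -> Prop) (c : K -> L) (G : K -> V) :
  (forall k k', P k -> P k' -> c k = c k' -> k = k') ->
  exists b, forall k, P k -> lt (G k) b.
Proof.
move=> cI; apply: contrapT => /forallNP nb; apply: VL.
have /choice[k kP] : forall b, exists k, P k /\ ~ lt (G k) b.
  by move=> b; have /existsNP[k /not_implyP[Pk h]] := nb b; exists k.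
have [i ii] := infL; have /choice[cd cdP] := small.
apply: card_le_trans (card_le_seqfun powL).
exists (fun b m => match m with 0 => c (k b) | 1 => i `[< b = G (k b) >]
               | _ => cd (G (k b)) b end) => b b' E.
have [Pk bk] := kP b; have [Pk' bk'] := kP b'.
have ek : k b = k b' by apply: cI Pk Pk' (congr1 (@^~ 0) E).
have /= /ii e1 := congr1 (@^~ 1) E; have /= := congr1 (@^~ 2) E.
move: e1; case: asboolP => h1; case: asboolP => h2 // _ e2.
  by rewrite h1 h2 ek.
rewrite -ek in h2 bk' e2.
by apply: cdP e2; [have [|[]] := wo_total wolt b (G (k b)) | have [|[]] := wo_total wolt b' (G (k b))].
Qed.

Lemma bounded_nat (G : nat -> V) : exists b, forall k, lt (G k) b.
Proof.
have [i ii] := infL.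
by have [b bP] := @bounded_small nat (fun=> True) i G (fun k k' _ _ => @ii k k'); exists b => k; exact: bP.
Qed.

Lemma bounded2 x y : exists b, lt x b /\ lt y b.
Proof.
by have [b bP] := bounded_nat (fun k => if k is 0 then x else y); exists b; split;
   [exact: (bP 0) | exact: (bP 1)].
Qed.

(** * Finite lists as parameters, and clubs *)

Definition below (v : seq V) (g : V) := forall i, i < size v -> lt (nth g v i) g.

Lemma below_cons w v g : below (w :: v) g <-> lt w g /\ below v g.
Proof.
split=> [h|[wg vg] [|i]] //; last exact: vg.
by split=> [|i iv]; [exact: (h 0) | exact: (h i.+1)].
Qed.

Lemma below_cat v w g : below (v ++ w) g <-> below v g /\ below w g.
Proof.
elim: v => [|x v IH] /=; first by split=> [//|[]].
by rewrite !below_cons IH; tauto.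
Qed.

Lemma below_map (K : eqType) (f : K -> V) (s : seq K) g :
  (forall k, k \in s -> lt (f k) g) -> below (map f s) g.
Proof.
elim: s => [//|k s IH] h /=; apply/below_cons; split; first by apply: h; rewrite mem_head.
by apply: IH => k' k's; apply: h; rewrite in_cons k's orbT.
Qed.

(** Only lambda lists lie below g: the length followed by the codes of the entries is a sequence in
    L. *)
Lemma bounded_seq (G : seq V -> V) g : exists b, forall v, below v g -> lt (G v) b.
Proof.
have [i ii] := infL; have [c cI] := small g; have [p pI] := card_le_seqfun powL.
pose cd v := p (fun k => if k is k'.+1 then c (nth g v k') else i (size v)).
have [|b bP] := @bounded_small _ (below^~ g) cd G; last by exists b.
  move=> v w vg wg /pI E; have /ii sE := congr1 (@^~ 0) E.
  apply: (eq_from_nth (x0 := g)) => // k kv.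
  by apply: cI; [exact: vg | apply: wg; rewrite -sE | exact: (congr1 (@^~ k.+1) E)].
Qed.

(* The first conjunct, excluding the least element of V, makes closed_seq hold for
   the empty list. *)
Definition closed_under (B : V -> V) (d : V) :=
  (exists g, lt g d) /\ forall g, lt g d -> lt (B g) d.

(** Since d may be a successor, the list need not lie below some g < d; instead g is the maximum of
    the list and a given point below d. *)
Lemma below_lt v d : (exists g, lt g d) -> below v d ->
  exists g, lt g d /\ forall g', lt g g' -> below v g'.
Proof.
move=> [g0 g0d]; elim: v => [|w v IH] h; first by exists g0.
have [wd /IH[g [gd gP]]] := (below_cons w v d).1 h.
have [wg|nwg] := pselect (lt w g).
  by exists g; split=> // g' gg'; apply/below_cons; split; [exact: lt_trans gg' | exact: gP].
exists w; split=> // g' wg'; apply/below_cons; split=> //.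
by apply: gP; exact: ltNlt wg'.
Qed.

(** One unary function controls a function of lists: [B g] bounds G on the lists below some [u g]
    above g, and a list below d lies below [u g] for some g < d. *)
Lemma closed_seq (G : seq V -> V) :
  exists B, forall d, closed_under B d -> forall v, below v d -> lt (G v) d.
Proof.
have /choice[u uP] : forall g, exists g', lt g g'.
  by move=> g; have [g' [? _]] := bounded2 g g; exists g'.
have /choice[B BP] : forall g, exists b, forall v, below v (u g) -> lt (G v) b.
  by move=> g; exact: bounded_seq.
exists B => d [d0 dB] v vd; have [g [gd gP]] := below_lt d0 vd.
by apply: lt_trans (dB _ gd); apply: BP; exact: gP.
Qed.

Lemma closed_under_meet B1 B2 : exists B, forall d, closed_under B d ->
  closed_under B1 d /\ closed_under B2 d.
Proof.
have /choice[B BP] : forall g, exists b, lt (B1 g) b /\ lt (B2 g) b.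
  by move=> g; exact: bounded2.
exists B => d [d0 dB]; split; split=> // g gd; have [h1 h2] := BP g.
  exact: lt_trans h1 (dB _ gd).
exact: lt_trans h2 (dB _ gd).
Qed.

Lemma inhabited_V : inhabited V.
Proof.
apply: contrapT => nV; apply: VL; exists (fun v => False_rect L (nV (inhabits v))) => v.
by case: nV.
Qed.

(** Diagonal intersection of clubs indexed by lists. The point g at which [Bf v] is evaluated is put
    in front of v, which reduces it to closure under one function of lists. *)
Lemma closed_under_diag (Bf : seq V -> V -> V) : exists B, forall d, closed_under B d ->
  forall v, below v d -> closed_under (Bf v) d.
Proof.
have [v0] := inhabited_V.
have [B BP] := closed_seq (fun w => if w is g :: v then Bf v g else v0).
exists B => d dB v vd; split=> [|g gd]; first by case: dB.
by apply: (BP d dB (g :: v)); apply/below_cons.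
Qed.

Lemma strict_sup (K : Type) (f : K -> V) (P : K -> Prop) b :
  (forall k, P k -> lt (f k) b) ->
  exists m, (forall k, P k -> lt (f k) m) /\
    forall c, lt c m -> exists k, P k /\ ~ lt (f k) c.
Proof.
move=> /(lt_min (P := fun m => forall k, P k -> lt (f k) m))[m [mP mmin]].
exists m; split=> // c cm; apply: contrapT => /forallNP h.
apply: (mmin c) => // k Pk; apply: contrapT => nk; exact: (h k).
Qed.

(** The supremum of b, s b, s (s b), ..., where s x exceeds x and all B g with g at most x. *)
Lemma closed_unbounded B b : exists d, lt b d /\ closed_under B d.
Proof.
have /choice[s sP] : forall x, exists y, lt x y /\ forall g, ~ lt x g -> lt (B g) y.
  move=> x; have [u [xu _]] := bounded2 x x; have [c cI] := small u.
  have [|y yP] := @bounded_small V (fun g => ~ lt x g) c B.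
    by move=> g g' xg xg'; apply: cI; exact: ltNlt xu.
  have [z [xz yz]] := bounded2 x y; exists z; split=> // g xg.
  exact: lt_trans (yP _ xg) yz.
have [u uP] := bounded_nat (fun k => iter k s b).
have [d [dP dmin]] := @strict_sup nat (fun k => iter k s b) (fun=> True) u (fun k _ => uP k).
exists d; split; first exact: (dP 0).
split=> [|g /dmin[k [_ kg]]]; first by exists b; exact: (dP 0).
by apply: lt_trans (dP k.+1 I); apply: (sP _).2.
Qed.

Lemma closed_next B : exists N : V -> V, forall b, [/\ lt b (N b), closed_under B (N b) &
  forall d, closed_under B d -> lt b d -> ~ lt d (N b)].
Proof.
apply: (exists_fun (P := fun b n => [/\ lt b n, closed_under B n &
  forall d, closed_under B d -> lt b d -> ~ lt d n])) => b.
have [d0 d0P] := closed_unbounded B b.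
have [m [[bm mB] mmin]] := lt_min (P := fun d => lt b d /\ closed_under B d) d0P.
by exists m; split=> // d dB bd; exact: mmin.
Qed.

(** The supremum of the closed points up to b is closed, hence the largest of them. In the first
    alternative there are none and C b is arbitrary. *)
Lemma closed_prev B : exists C : V -> V, forall b,
  (forall d, closed_under B d -> lt b d) \/
  [/\ closed_under B (C b), ~ lt b (C b) & forall d, closed_under B d -> ~ lt b d -> ~ lt (C b) d].
Proof.
apply: (exists_fun (P := fun b c => (forall d, closed_under B d -> lt b d) \/
  [/\ closed_under B c, ~ lt b c & forall d, closed_under B d -> ~ lt b d -> ~ lt c d])) => b.
have [h|/existsNP[d0 /not_implyP[d0B d0b]]] := pselect (forall d, closed_under B d -> lt b d).
  by exists b; left; exact: h.
have [|m [mub mmin]] := lt_min (P := fun m => forall d, closed_under B d -> ~ lt b d -> ~ lt m d) (x := b).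
  by [].
exists m; right; split=> //; last by apply: mmin.
split=> [|g gm].
  have [[g gd0] _] := d0B; exists g; exact: lt_Nlt gd0 (mub _ d0B d0b).
have /existsNP[d /not_implyP[dB /not_implyP[db /contrapT gd]]] : ~ forall d, closed_under B d -> ~ lt b d -> ~ lt g d.
  by move=> h; exact: (mmin g h).
exact: lt_Nlt (dB.2 _ gd) (mub _ dB db).
Qed.

(** * Finite alternation of two families of points *)

(** Insertion sort by the values of a, dropping terms whose value is already present. *)
Lemma increasing_subseq (T : eqType) (a : T -> V) (ts : seq T) : exists us : seq T,
  [/\ pairwise (fun s t => `[< lt (a s) (a t) >]) us, {subset us <= ts} &
      forall t, t \in ts -> exists2 u, u \in us & a u = a t].
Proof.
elim: ts => [|t ts [us [inc sub cov]]]; first by exists [::].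
have [[u uus ut]|new] := pselect (exists2 u, u \in us & a u = a t).
  exists us; split=> // [v /sub|v]; first by rewrite in_cons => ->; rewrite orbT.
  by rewrite in_cons => /predU1P[->|/cov//]; exists u.
pose lo := [seq u <- us | `[< lt (a u) (a t) >]]; pose hi := [seq u <- us | `[< lt (a t) (a u) >]].
exists (lo ++ t :: hi); split.
- rewrite pairwise_cat /= allrel_consr !pairwise_filter // !andbT -andbA.
  apply/and3P; split; try by apply/allP => u; rewrite mem_filter => /andP[].
  apply/allrelP => u v; rewrite !mem_filter => /andP[/asboolP ut _] /andP[/asboolP tv _].
  by apply/asboolP; exact: lt_trans ut tv.
- move=> u; rewrite mem_cat !in_cons !mem_filter orbCA => /or3P[->//|/andP[_ /sub->]|/andP[_ /sub->]];
    exact: orbT.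
move=> v; rewrite in_cons => /predU1P[->|/cov[u uus <-]].
  by exists t => //; rewrite mem_cat mem_head orbT.
exists u => //; rewrite mem_cat in_cons !mem_filter uus !andbT.
have [e|[l|l]] := wo_total wolt (a u) (a t); first by case: new; exists u.
  by rewrite asboolT.
by rewrite (asboolT l) !orbT.
Qed.

Definition positions (b : bool) (s : seq bool) (m : nat) :=
  [seq j <- iota m (size s) | nth false s (j - m) == b].

Lemma positions_cons b c s m :
  positions b (c :: s) m = (if c == b then [:: m] else [::]) ++ positions b s m.+1.
Proof.
rewrite /positions /= subnn /=.
have -> : [seq j <- iota m.+1 (size s) | nth false (c :: s) (j - m) == b] =
    [seq j <- iota m.+1 (size s) | nth false s (j - m.+1) == b].
  by apply: eq_in_filter => j; rewrite mem_iota => /andP[mj _]; rewrite -[j - m]prednK ?subn_gt0 //= subnS.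
by case: ifP.
Qed.

Lemma positions_ge b s m i : i < size (positions b s m) -> m <= nth 0 (positions b s m) i.
Proof. by move=> /(mem_nth 0); rewrite mem_filter mem_iota => /and3P[]. Qed.

Definition increasing (al : seq V) := forall d i j, i < j -> j < size al -> lt (nth d al i) (nth d al j).

Lemma increasing_behead x al : increasing (x :: al) -> increasing al.
Proof. by move=> h d i j ij js; exact: (h d i.+1 j.+1). Qed.

(** The word s records the merge of the lists, false for an entry of al and true for one of be; the
    least head is removed at each step. All offsets m are treated at once because the induction
    shifts them. *)
Lemma interleaving (al be : seq V) : increasing al -> increasing be ->
  (forall d i j, i < size al -> j < size be -> nth d al i <> nth d be j) ->
  exists s : seq bool, forall m, [/\ size s = size al + size be,
    size (positions false s m) = size al, size (positions true s m) = size be &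
    forall d i j, i < size al -> j < size be ->
      (lt (nth d al i) (nth d be j) /\ nth 0 (positions false s m) i < nth 0 (positions true s m) j) \/
      (lt (nth d be j) (nth d al i) /\ nth 0 (positions true s m) j < nth 0 (positions false s m) i)].
Proof.
have [n] := ubnP (size al + size be); elim: n al be => // n IH al be sn ia ib dis.
have [[x [al' [ea hx]]]|na] := pselect (exists x al', al = x :: al' /\
    forall d j, j < size be -> lt x (nth d be j)).
  rewrite {al}ea in ia dis sn *.
  have [|s sP] := IH al' be sn (increasing_behead ia) ib.
    by move=> d i j i1 j1; exact: (dis d i.+1 j).
  exists (false :: s) => m; have [e1 e2 e3 P] := sP m.+1.
  rewrite !positions_cons /= e1 e2 e3 addSn; split=> // d [|i] j /= i1 j1; last exact: P.
  by left; split; [exact: hx | apply: positions_ge; rewrite e3].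
have [[y [be' [eb hy]]]|nb] := pselect (exists y be', be = y :: be' /\
    forall d i, i < size al -> lt y (nth d al i)).
  rewrite {be}eb in ib dis sn na *.
  have [||s sP] := IH al be' _ ia (increasing_behead ib); first by rewrite addnS in sn.
    by move=> d i j i1 j1; exact: (dis d i j.+1).
  exists (true :: s) => m; have [e1 e2 e3 P] := sP m.+1.
  rewrite !positions_cons /= e1 e2 e3 addnS; split=> // d i [|j] /= i1 j1; last exact: P.
  by right; split; [exact: hy | apply: positions_ge; rewrite e2].
case: al be {IH sn} ia ib dis na nb => [|x al] [|y be] ia ib dis na nb.
- by exists [::].
- by case: nb; exists y, be.
- by case: na; exists x, al.
have [e|[l|l]] := wo_total wolt x y; first by case: (dis x 0 0).
  case: na; exists x, al; split=> // d [//|j] jb; exact: lt_trans l (ib d 0 j.+1 _ _).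
case: nb; exists y, be; split=> // d [//|i] ib'; exact: lt_trans l (ia d 0 i.+1 _ _).
Qed.

Section Alternation.
Variables (T : eqType) (a b : T -> V).
Local Notation shared t := (a t = b t).
Hypothesis ordE : forall s t, lt (a s) (a t) <-> lt (b s) (b t).
Hypothesis meetP : forall s t, a s = b t -> shared s.
Hypothesis sharedW : forall s t, shared s -> lt (a t) (a s) -> shared t.
Hypothesis no_common_limit : forall d,
  (forall c, lt c d -> exists t, [/\ ~ shared t, ~ lt (a t) c & lt (a t) d]) ->
  (forall c, lt c d -> exists t, [/\ ~ shared t, ~ lt (b t) c & lt (b t) d]) ->
  (exists t, lt (a t) d) -> False.
Hypothesis bounded : exists d, forall t, lt (a t) d /\ lt (b t) d.

(** In the application a t and b t are the values of the term t at the two ends of an edge. A start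
    opens a maximal block of unshared values of one side, uninterrupted by unshared values of the
    other. *)
Definition a_start t := ~ shared t /\
  forall s, ~ shared s -> lt (a s) (a t) -> exists w, [/\ ~ shared w, lt (a s) (b w) & lt (b w) (a t)].
Definition b_start t := ~ shared t /\
  forall s, ~ shared s -> lt (b s) (b t) -> exists w, [/\ ~ shared w, lt (b s) (a w) & lt (a w) (b t)].

Lemma a_eq_b_eq s t : a s = a t <-> b s = b t.
Proof.
by split=> e; apply: Nlt_eq => /ordE; rewrite e; exact: lt_irr.
Qed.

Lemma meet_shared s t : a s = b t -> shared t.
Proof.
by move=> e; have /a_eq_b_eq e' : b s = b t; [rewrite -(meetP e) | rewrite -e'].
Qed.

Lemma shared_lt s t : shared s -> ~ shared t -> lt (a s) (a t) /\ lt (b s) (b t).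
Proof.
move=> ss nst; suff: lt (a s) (a t) by split=> //; exact/ordE.
have [e|[//|l]] := wo_total wolt (a s) (a t); last by case: nst; exact: sharedW l.
by case: nst; apply: (meet_shared (s := s)); rewrite ss; apply/a_eq_b_eq.
Qed.

(** Induction on a bound d. If the unshared values of one side avoid the points from some c < d up
    to d, at most one start lies there and the rest are below c. Otherwise both sides accumulate at
    d, which [no_common_limit] excludes. *)
Lemma finitely_many_starts : exists ts : seq T,
  (forall t, t \in ts -> a_start t \/ b_start t) /\
  (forall t, a_start t \/ b_start t -> exists2 t', t' \in ts & a t' = a t).
Proof.
suff H d : exists ts : seq T, (forall t, t \in ts -> a_start t \/ b_start t) /\
    (forall t, a_start t /\ lt (a t) d \/ b_start t /\ lt (b t) d -> exists2 t', t' \in ts & a t' = a t).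
  have [d dP] := bounded; have [ts [tsP cov]] := H d; exists ts; split=> // t st; apply: cov.
  by have [] := dP t; case: st; [left|right].
elim/(well_founded_ind (wo_wf wolt)): d => d IH.
(* If one side does not meet [c, d), the other side has at most one start there. *)
have step (P : V -> Prop) (ts0 : seq T) : (forall t, t \in ts0 -> a_start t \/ b_start t) ->
    (forall t, a_start t /\ lt (a t) d \/ b_start t /\ lt (b t) d ->
      ((a_start t /\ P (a t)) \/ (b_start t /\ P (b t))) \/ exists2 t', t' \in ts0 & a t' = a t) ->
    (forall x y, P x -> lt x y -> lt y d -> P y) -> (forall x, P x -> lt x d) ->
    (forall t, ~ shared t -> ~ P (a t)) \/ (forall t, ~ shared t -> ~ P (b t)) ->
    exists ts : seq T, (forall t, t \in ts -> a_start t \/ b_start t) /\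
    (forall t, a_start t /\ lt (a t) d \/ b_start t /\ lt (b t) d -> exists2 t', t' \in ts & a t' = a t).
  move=> ts0P cov up Pd one.
  have uniq t t' : (a_start t /\ P (a t)) \/ (b_start t /\ P (b t)) ->
      (a_start t' /\ P (a t')) \/ (b_start t' /\ P (b t')) -> a t = a t'.
    case: one => one.
      have onb u : (a_start u /\ P (a u)) \/ (b_start u /\ P (b u)) -> b_start u /\ P (b u).
        by case=> // -[[nu _] /(one _ nu)].
      move=> /onb[[nt bt] Pt] /onb[[nt' bt'] Pt']; apply/a_eq_b_eq; apply: Nlt_eq => l.
        by have [w [nw l1 l2]] := bt' _ nt l; case: (one w nw); exact: (up _ _ Pt l1 (lt_trans l2 (Pd _ Pt'))).
      by have [w [nw l1 l2]] := bt _ nt' l; case: (one w nw); exact: (up _ _ Pt' l1 (lt_trans l2 (Pd _ Pt))).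
    have ona u : (a_start u /\ P (a u)) \/ (b_start u /\ P (b u)) -> a_start u /\ P (a u).
      by case=> // -[[nu _] /(one _ nu)].
    move=> /ona[[nt bt] Pt] /ona[[nt' bt'] Pt']; apply: Nlt_eq => l.
      by have [w [nw l1 l2]] := bt' _ nt l; case: (one w nw); exact: (up _ _ Pt l1 (lt_trans l2 (Pd _ Pt'))).
    by have [w [nw l1 l2]] := bt _ nt' l; case: (one w nw); exact: (up _ _ Pt' l1 (lt_trans l2 (Pd _ Pt))).
  have [[t0 t0P]|no] := pselect (exists t, (a_start t /\ P (a t)) \/ (b_start t /\ P (b t))).
    exists (t0 :: ts0); split=> [t|t /cov[tP|[t' t'0 e]]].
    - by rewrite in_cons => /predU1P[->|/ts0P//]; case: t0P => -[]; [left|right].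
    - by exists t0; [rewrite mem_head | exact: uniq].
    - by exists t' => //; rewrite in_cons t'0 orbT.
  by exists ts0; split=> // t /cov[tP|//]; case: no; exists t.
have [ga|/existsNP[c /not_implyP[cd nc]]] := pselect (forall c, lt c d ->
    exists t, [/\ ~ shared t, ~ lt (a t) c & lt (a t) d]); last first.
  have [ts0 [ts0P cov]] := IH c cd; apply: (step (fun x => ~ lt x c /\ lt x d) ts0) => //.
  - move=> t st; have [/cov|] := pselect (a_start t /\ lt (a t) c \/ b_start t /\ lt (b t) c).
      by right.
    by tauto.
  - by move=> x y [nxc _] xy yd; split=> // yc; apply: nxc; exact: lt_trans xy yc.
  - by move=> x [].
  - by left=> t nt [h1 h2]; apply: nc; exists t.
have [gb|/existsNP[c /not_implyP[cd nc]]] := pselect (forall c, lt c d ->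
    exists t, [/\ ~ shared t, ~ lt (b t) c & lt (b t) d]); last first.
  have [ts0 [ts0P cov]] := IH c cd; apply: (step (fun x => ~ lt x c /\ lt x d) ts0) => //.
  - move=> t st; have [/cov|] := pselect (a_start t /\ lt (a t) c \/ b_start t /\ lt (b t) c).
      by right.
    by tauto.
  - by move=> x y [nxc _] xy yd; split=> // yc; apply: nxc; exact: lt_trans xy yc.
  - by move=> x [].
  - by right=> t nt [h1 h2]; apply: nc; exists t.
(* By [no_common_limit] no a-value lies below d, so the argument covers the whole segment below d,
   with no earlier starts. *)
apply: (step (fun x => lt x d) [::]) => //; first by move=> t; left.
by left=> t nt ltd; apply: (no_common_limit ga gb); exists t.
Qed.

(** The block of t starts at the least unshared a-value that no unshared b-value separates from a
    t. *)
Lemma a_start_below t : ~ shared t -> exists s, [/\ a_start s, ~ lt (a t) (a s) &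
  forall w, ~ shared w -> lt (a s) (b w) -> ~ lt (b w) (a t)].
Proof.
move=> nt.
pose Q x := exists s, [/\ a s = x, ~ shared s, ~ lt (a t) (a s) &
  forall w, ~ shared w -> lt (a s) (b w) -> ~ lt (b w) (a t)].
have [|x [[s [sx ns sle nw]] xmin]] := lt_min (P := Q) (x := a t).
  by exists t; split=> // [|w _]; [exact: lt_irr | exact: lt_asym].
exists s; split=> //; split=> // u nu us; apply: contrapT => no.
apply: (xmin (a u)); last by rewrite -sx.
exists u; split=> // [ul|w nsw uw wt]; first by apply: sle; exact: lt_trans ul us.
have [e|[l|l]] := wo_total wolt (b w) (a s).
- by apply: nsw; exact: (meet_shared (esym e)).
- by apply: no; exists w.
- exact: (nw w).
Qed.

End Alternation.

(** * Starts of blocks are closed points and bound the blocks tightly *)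

Definition prev_closed (B : V -> V) (d x : V) := [/\ closed_under B d, ~ lt x d &
  forall d', closed_under B d' -> ~ lt x d' -> ~ lt d d'].
Definition next_closed (B : V -> V) (d x : V) := [/\ lt x d, closed_under B d &
  forall d', closed_under B d' -> lt x d' -> ~ lt d' d].

Lemma prev_next_closed B d x y x' y' : prev_closed B d x -> prev_closed B d y ->
  next_closed B x' x -> next_closed B y' y -> x' = y'.
Proof.
suff H u v u' v' : prev_closed B d u -> prev_closed B d v ->
    next_closed B u' u -> next_closed B v' v -> ~ lt u' v'.
  by move=> dx dy xx' yy'; apply: Nlt_eq; [exact: (H x y) | exact: (H y x)].
move=> [_ ud _] [_ _ vmax] [uu' Bu' _] [_ _ vmin] l.
by apply: (vmax u') => // [vu'|]; [exact: (vmin u') | exact: ltNlt uu'].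
Qed.

(** The shared closed point m ensures that previous closed points exist. If a t were not closed,
    some b-value would have the same previous, hence the same next closed point: b t itself if
    [cT t] is shared, otherwise an unshared b-value separating C (a t) from a t. Then [nT t] would
    be shared, and with it the smaller t. *)
Lemma start_closed (T : eqType) (a b : T -> V) (B C N : V -> V) (m : V) (cT nT : T -> T) (mT : T) :
  (forall s t, lt (a s) (a t) <-> lt (b s) (b t)) ->
  (forall s t, a s = b t -> a s = b s) ->
  (forall s t, a s = b s -> lt (a t) (a s) -> a t = b t) ->
  closed_under B m ->
  (forall x, (forall d, closed_under B d -> lt x d) \/ prev_closed B (C x) x) ->
  (forall x, next_closed B (N x) x) ->
  (forall t, a (cT t) = C (a t) /\ b (cT t) = C (b t)) ->
  (forall t, a (nT t) = N (a t) /\ b (nT t) = N (b t)) ->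
  a mT = m /\ b mT = m ->
  forall t, a_start a b t -> closed_under B (a t) /\ closed_under B (b t).
Proof.
move=> ordE meetP sharedW Bm CP NP cE nE [amT bmT] t [nt st].
have [lma lmb] : lt m (a t) /\ lt m (b t).
  by rewrite -{1}amT -bmT; apply: (shared_lt ordE meetP sharedW); rewrite ?amT ?bmT.
have prev x : lt m x -> prev_closed B (C x) x.
  by move=> mx; have [/(_ _ Bm)/(lt_asym mx)|] := CP x.
have pa := prev _ lma; have pb := prev _ lmb.
have nnt : a (nT t) <> b (nT t).
  move=> e; apply: nt; apply: sharedW e _; rewrite (nE t).1; by case: (NP (a t)).
have Ba : closed_under B (a t).
  have [BC ltC maxC] := pa; apply: contrapT => nB.
  have Clt : lt (a (cT t)) (a t).
    rewrite (cE t).1; have [e|[//|//]] := wo_total wolt (C (a t)) (a t); by rewrite e in BC.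
  have [sh|nsh] := pselect (a (cT t) = b (cT t)).
    apply: nnt; rewrite (nE t).1 (nE t).2; apply: (prev_next_closed pa _ (NP _) (NP _)).
    by rewrite -(cE t).1 sh (cE t).2.
  have [w [nw l1 l2]] := st _ nsh Clt; rewrite (cE t).1 in l1.
  apply: nnt; apply: (meetP _ (nT w)); rewrite (nE t).1 (nE w).2.
  apply: (prev_next_closed pa _ (NP _) (NP _)); split=> // [|d Bd wd].
    exact: lt_asym.
  by apply: maxC => // td; apply: wd; exact: lt_trans l2 td.
split=> //; have [BC ltC maxC] := pb.
suff -> : b t = C (b t) by [].
(* As C (a t) equals a t, the common order pattern of the terms carries the equality over to b. *)
rewrite -(cE t).2; apply/(a_eq_b_eq ordE); rewrite (cE t).1.
have [_ h1 h2] := pa; apply: Nlt_eq => // l; exact: (h2 _ Ba (@lt_irr _)).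
Qed.

(** Below the first start there is no block, so everything is shared. If an unshared a f exceeded
    the j-th b-value, so would the start of its block; that start would come after the i-th one,
    although a f lies below the next. *)
Lemma starts_tight (T : eqType) (a b : T -> V) (t0 : T) (us : seq T) :
  (forall s t, lt (a s) (a t) <-> lt (b s) (b t)) ->
  (forall s t, a s = b t -> a s = b s) ->
  (forall s t, a s = b s -> lt (a t) (a s) -> a t = b t) ->
  (forall i, i < size us -> a (nth t0 us i) <> b (nth t0 us i)) ->
  (forall i j, i < j -> j < size us -> lt (a (nth t0 us i)) (a (nth t0 us j))) ->
  (forall t, a_start a b t -> exists2 i, i < size us & a (nth t0 us i) = a t) ->
  (forall f, lt (a f) (a (nth t0 us 0)) -> a f = b f) /\
  (forall f i j, i < size us -> j < size us -> lt (a (nth t0 us i)) (b (nth t0 us j)) ->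
     (i.+1 < size us -> lt (a f) (a (nth t0 us i.+1))) -> lt (a f) (b (nth t0 us j))).
Proof.
move=> ordE meetP sharedW nsh inc cov.
have le i j : i <= j -> j < size us -> ~ lt (a (nth t0 us j)) (a (nth t0 us i)).
  by rewrite leq_eqVlt => /predU1P[->|ij] ju; [exact: lt_irr | exact: lt_asym (inc _ _ ij ju)].
split=> [f fl|f i j iu ju ij fi].
  apply: contrapT => nf; have [s [st fs _]] := a_start_below ordE meetP nf.
  have [i iu e] := cov _ st; apply: (le 0 i) => //; rewrite e; exact: ltNlt fs fl.
have [sf|nf] := pselect (a f = b f).
  by rewrite sf; have [] := shared_lt ordE meetP sharedW sf (nsh _ ju).
have [e|[//|l]] := wo_total wolt (a f) (b (nth t0 us j)).
  by case: nf; exact: meetP e.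
have [s [st fs nw]] := a_start_below ordE meetP nf.
have [k ku e] := cov _ st.
have ls : lt (b (nth t0 us j)) (a s).
  have [e'|[//|l']] := wo_total wolt (b (nth t0 us j)) (a s); last by case: (nw _ (nsh _ ju) l').
  by case: (nsh _ ju); apply: (meet_shared ordE meetP (esym e')).
have ik : i < k.
  by rewrite ltnNge; apply/negP => /le h; apply: h => //; rewrite e; exact: lt_trans ij ls.
case: (le i.+1 k ik ku); rewrite e; apply: ltNlt fs _; apply: fi; exact: leq_ltn_trans ku.
Qed.

(** A limit d is the supremum of the values below d. These are all values, or those below the least
    value f t0 that is at least d; so countably many suprema suffice. *)
Lemma sup_terms (T : countType) (f : T -> V) : exists S : option T -> V,
  forall d, (forall c, lt c d -> exists t, ~ lt (f t) c /\ lt (f t) d) -> (exists t, lt (f t) d) ->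
  exists o, S o = d.
Proof.
have [v0] := inhabited_V.
have [m mP] := bounded_nat (fun k => if unpickle k is Some t then f t else v0).
have mT t : lt (f t) m by have := mP (pickle t); rewrite pickleK.
have /choice[S SP] : forall o, exists d, (forall t, (if o is Some t0 then lt (f t) (f t0) else True) -> lt (f t) d) /\
    forall c, lt c d -> exists t, (if o is Some t0 then lt (f t) (f t0) else True) /\ ~ lt (f t) c.
  by move=> o; apply: (@strict_sup T f _ m) => t _.
exists S => d dP [t td].
have [o oP] : exists o, forall s, (if o is Some t0 then lt (f s) (f t0) else True) <-> lt (f s) d.
  have [[s ds]|no] := pselect (exists s, ~ lt (f s) d); last first.
    by exists None => s; split=> // _; apply: contrapT => h; apply: no; exists s.
  have [x [[t0 [e dt0]] xmin]] := lt_min (P := fun x => exists t, f t = x /\ ~ lt x d) (ex_intro _ s (conj erefl ds)).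
  exists (Some t0) => u; rewrite e; split=> [ul|ud]; last by exact: lt_Nlt ud dt0.
  by apply: contrapT => nud; apply: (xmin (f u)) => //; exists u.
exists o; have [h1 h2] := SP o; apply: Nlt_eq => l.
  by have [u [ul ud]] := dP _ l; apply: ul; apply: h1; exact/oP.
by have [u [/oP ud nud]] := h2 _ l.
Qed.

(** * The generic pattern *)

Hypothesis powV : card_le V (L -> bool).

(* The third and fourth colours are those of the shift graph: they exclude
   F s x = F t y when F s x <> F t x. *)
Lemma coherent_colouring (T : countType) (F : T -> V -> V) :
  exists (K : countType) (kap : K -> V -> L), forall x y, (forall k, kap k x = kap k y) ->
  [/\ forall s t, lt (F s x) (F t x) <-> lt (F s y) (F t y),
      forall s t, F s x = F t y -> F s x = F s y &
      forall s t, F s x = F s y -> lt (F t x) (F s x) -> F t x = F t y].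
Proof.
have [i ii] := infL; have [r rI] := powV; have /choice[cd cdP] := small.
(* A coordinate at which the subsets of L coding u and v differ; i 0 is a default for u = v. *)
have /choice[ell ellP] : forall p : V * V, exists l, p.1 <> p.2 -> r p.1 l <> r p.2 l.
  move=> [u v] /=; have [e|ne] := pselect (u = v); first by exists (i 0).
  apply: contrapT => /forallNP h; apply: ne; apply: rI; apply: funext => l.
  by apply: contrapT => nl; exact: (h l).
pose kap (k : T * T * nat) x := let: (s, t, j) := k in match j with
  | 0 => i `[< lt (F s x) (F t x) >]
  | 1 => cd (F s x) (F t x)
  | 2 => ell (F s x, F t x)
  | _ => i (r (F s x) (ell (F s x, F t x))) end.
exists (T * T * nat)%type, kap => x y kxy.
have ordE s t : lt (F s x) (F t x) <-> lt (F s y) (F t y).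
  have /ii := kxy (s, t, 0); case: asboolP => h1; case: asboolP => h2 // _; tauto.
have eqE s t : F s x = F t x <-> F s y = F t y.
  by split=> e; apply: Nlt_eq => /ordE; rewrite e; exact: lt_irr.
split=> // s t.
  move=> e; have [/eqE e'|ne] := pselect (F s x = F t x); first by rewrite e e'.
  have el : ell (F s x, F t x) = ell (F s y, F t y) := kxy (s, t, 2).
  have e3 : r (F s x) (ell (F s x, F t x)) = r (F s y) (ell (F s y, F t y)).
    by have /ii /= := kxy (s, t, 3); case: (r _ _); case: (r _ _).
  by case: (ellP (F s y, F t y)) => /=; [move/eqE | rewrite -e3 el e].
(* The second colour codes F t x among the points below F s x, so it determines that point once F s
   x = F s y. *)
move=> e l; have h := kxy (s, t, 1); rewrite /= -e in h.
by apply: cdP h => //; rewrite e; exact/ordE.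
Qed.

(* The values of Phi below h 1 are common to x and y, and those in the i-th block of
   one end precede every block of the other end starting after h i. *)
Record generic_pair (n : nat) (e : nat -> bool) (h : nat -> V -> V)
    (B : V -> V) (Phi : nat -> V -> V) (x y : V) : Prop := GenericPair {
  pair_closed : forall i, 1 <= i <= n -> closed_under B (h i x) /\ closed_under B (h i y);
  pair_incr : forall i, 1 <= i -> i < n -> lt (h i x) (h i.+1 x) /\ lt (h i y) (h i.+1 y);
  pair_lt : forall i j, 1 <= i <= n -> 1 <= j <= n -> a_idx n e i < b_idx n e j -> lt (h i x) (h j y);
  pair_root : forall k, lt (Phi k x) (h 1 x) -> Phi k x = Phi k y;
  pair_tightl : forall k i j, 1 <= i <= n -> 1 <= j <= n -> a_idx n e i < b_idx n e j ->
    (i < n -> lt (Phi k x) (h i.+1 x)) -> lt (Phi k x) (h j y);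
  pair_tightr : forall k i j, 1 <= i <= n -> 1 <= j <= n -> b_idx n e j < a_idx n e i ->
    (j < n -> lt (Phi k y) (h j.+1 y)) -> lt (Phi k y) (h i x) }.

Variable E : V -> V -> Prop.
Hypothesis irrE : forall x, ~ E x x.
Hypothesis uncolE : ~ colorable E L.

(** As lambda^aleph_0 = lambda, countably many colourings combine into one with colours in L. *)
Lemma monochromatic_edge (K : countType) (kap : K -> V -> L) :
  exists x y, E x y /\ forall k, kap k x = kap k y.
Proof.
have [i _] := infL; have [p pI] := card_le_seqfun powL.
apply: contrapT => no; apply: uncolE.
exists (fun x => p (fun m => if unpickle m is Some k then kap k x else i 0)) => x y xy /pI e.
by apply: no; exists x, y; split=> // k; have := congr1 (@^~ (pickle k)) e; rewrite pickleK.
Qed.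

Lemma nth_map_fun (T : Type) (F : T -> V -> V) t0 us i x :
  i < size us -> nth id (map F us) i x = F (nth t0 us i) x.
Proof. by move=> iu; rewrite (nth_map t0). Qed.

(** Terms are coded by trees to have a [countType]; a leaf stands for the vertex itself. *)
Fixpoint eval_tree (op : nat -> seq (V -> V) -> V -> V) (t : GenTree.tree nat) : V -> V :=
  if t is GenTree.Node k ts then op k (map (eval_tree op) ts) else id.

(** Otherwise each pattern p has data [D p] destroying it. The terms are closed under the functions
    of [D p] for all patterns p whose h_i are terms, and a monochromatic edge yields such a pattern
    surviving its own data. *)
Lemma generic_pattern : exists n e h, [/\ 1 <= n, count (fun j => ~~ e j) (iota 1 (2 * n)) = n &
  forall B Phi (kap : nat -> V -> L), exists x y,
    [/\ E x y, forall k, kap k x = kap k y & generic_pair n e h B Phi x y]].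
Proof.
(* Blocks and the h_i are numbered from 1, lists from 0. *)
pose pat (s : seq bool) j := nth false s j.-1.
pose ht (hs : seq (V -> V)) i := nth id hs i.-1.
apply: contrapT => noP.
have /choice[D DP] : forall p : seq bool * seq (V -> V), exists q : (V -> V) * (nat -> V -> V) * (nat -> V -> L),
    1 <= size p.2 -> count (fun j => ~~ pat p.1 j) (iota 1 (2 * size p.2)) = size p.2 ->
    forall x y, E x y -> (forall k, q.2 k x = q.2 k y) ->
    ~ generic_pair (size p.2) (pat p.1) (ht p.2) q.1.1 q.1.2 x y.
  move=> [s hs] /=; have [[n1 ce]|no] := pselect (1 <= size hs /\
      count (fun j => ~~ pat s j) (iota 1 (2 * size hs)) = size hs); last first.
    have [i _] := infL; exists (id, fun=> id, fun _ _ => i 0) => n1 ce; by case: no.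
  apply: contrapT => /forallNP h; apply: noP; exists (size hs), (pat s), (ht hs); split=> // B Phi kap.
  apply: contrapT => noE; apply: (h (B, Phi, kap)) => _ _ x y xy kxy gp.
  by apply: noE; exists x, y.
have /choice[N NP] := closed_next; have /choice[C CP] := closed_prev; have [v0] := inhabited_V.
have /choice[M MP] : forall B, exists m, closed_under B m.
  by move=> B; have [m []] := closed_unbounded B v0; exists m.
(* A symbol holds a word, a tag and an index. Tag 0 is a function from the data of the pattern (s,
   fs). Tags 1 and 2 are the previous and next closed point of the first argument, the other
   arguments forming the pattern. Higher tags are a fixed closed point. *)
pose op k (fs : seq (V -> V)) (x : V) := match unpickle k : option (seq bool * nat * nat) with
  | Some (s, 0, j) => (D (s, fs)).1.2 j x
  | Some (s, 1, _) => C (D (s, behead fs)).1.1 (head id fs x)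
  | Some (s, 2, _) => N (D (s, behead fs)).1.1 (head id fs x)
  | Some (s, _, _) => M (D (s, fs)).1.1
  | None => x end.
pose T : countType := GenTree.tree nat; pose F := eval_tree op : T -> V -> V.
have opE k ts x : F (GenTree.Node k ts) x = op k (map F ts) x by [].
have /choice[S SP] : forall x, exists S : option T -> V, forall d,
    (forall c, lt c d -> exists t, ~ lt (F t x) c /\ lt (F t x) d) -> (exists t, lt (F t x) d) ->
    exists o, S o = d.
  by move=> x; have [S SP] := sup_terms (F^~ x); exists S.
pose F' (q : T + option T) x := match q with inl t => F t x | inr o => S x o end.
have [K [kap0 kapP]] := coherent_colouring F'.
pose kap (k : K + seq bool * seq T * nat) := match k with
  | inl k => kap0 k | inr (s, ts, j) => (D (s, map F ts)).2 j end.
have [x [y [xy kxy]]] := monochromatic_edge kap.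
have [ordE' meetP' sharedW'] := kapP x y (fun k => kxy (inl k)).
pose a t := F t x; pose b t := F t y.
have ordE s t : lt (a s) (a t) <-> lt (b s) (b t) by exact: (ordE' (inl s) (inl t)).
have meetP s t : a s = b t -> a s = b s by exact: (meetP' (inl s) (inl t)).
have sharedW s t : a s = b s -> lt (a t) (a s) -> a t = b t by exact: (sharedW' (inl s) (inl t)).
have ordEC s t : lt (b s) (b t) <-> lt (a s) (a t) by rewrite ordE.
have meetPC s t : b s = a t -> b s = a s.
  by move=> /esym e; rewrite (meet_shared ordE meetP e).
have sharedWC s t : b s = a s -> lt (b t) (b s) -> b t = a t.
  by move=> e /ordEC l; rewrite (sharedW _ _ (esym e) l).
have [ts [tsP cov]] : exists ts : seq T, (forall t, t \in ts -> a_start a b t \/ b_start a b t) /\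
    (forall t, a_start a b t \/ b_start a b t -> exists2 t', t' \in ts & a t' = a t).
  (* A common limit is a value of S at both ends, hence shared, and all values below a shared one
     are shared. *)
  apply: (finitely_many_starts ordE) => [d ga gb ex|].
    have wk (f : T -> V) : (forall c, lt c d -> exists t, [/\ a t <> b t, ~ lt (f t) c & lt (f t) d]) ->
        forall c, lt c d -> exists t, ~ lt (f t) c /\ lt (f t) d.
      by move=> h c /h[t [_ ? ?]]; exists t.
    have [o1 e1] := SP x d (wk a ga) ex.
    have [o2 e2] : exists o, S y o = d.
      by apply: SP (wk b gb) _; have [t /gb[s [_ _ l]]] := ex; exists s.
    have [t td] := ex; have [s [ns _ sd]] := ga _ td; apply: ns.
    rewrite -e1 in sd.
    exact: (sharedW' (inr o1) (inl s) (meetP' (inr o1) (inr o2) (eq_trans e1 (esym e2))) sd).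
  have [d1 h1] := bounded_nat (fun k => if unpickle k is Some t then a t else x).
  have [d2 h2] := bounded_nat (fun k => if unpickle k is Some t then b t else x).
  have [d [l1 l2]] := bounded2 d1 d2; exists d => t; split.
    by apply: lt_trans l1; have := h1 (pickle t); rewrite pickleK.
  by apply: lt_trans l2; have := h2 (pickle t); rewrite pickleK.
have [us [usinc usts uscov]] := increasing_subseq a ts.
have {}cov t : a_start a b t \/ b_start a b t -> exists2 u, u \in us & a u = a t.
  by move=> /cov[t' /uscov[u uus e] e']; exists u => //; rewrite e.
pose t0 : T := GenTree.Leaf 0.
have usP i : i < size us -> a_start a b (nth t0 us i) \/ b_start a b (nth t0 us i).
  by move=> iu; apply: tsP; apply: usts; exact: mem_nth.
have nsh i : i < size us -> a (nth t0 us i) <> b (nth t0 us i) by move=> /usP[][].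
have inc i j : i < j -> j < size us -> lt (a (nth t0 us i)) (a (nth t0 us j)).
  move=> ij ju; apply/asboolP; move/(pairwiseP t0): usinc; apply => //; exact: ltn_trans ju.
have cova t : a_start a b t -> exists2 i, i < size us & a (nth t0 us i) = a t.
  move=> st; have [|u uus e] := cov t; first by left.
  by exists (index u us); rewrite ?index_mem ?nth_index.
have covb t : a_start b a t -> exists2 i, i < size us & b (nth t0 us i) = b t.
  move=> [nt st]; have [|u uus e] := cov t.
    right; split=> [/esym//|u nu ut]; have [|w [nw l1 l2]] := st u _ ut; first by move/esym.
    by exists w; split=> // /esym.
  by exists (index u us); rewrite ?index_mem ?nth_index //; apply/(a_eq_b_eq ordE).
(* The leaf takes the values x and y, which differ as E is irreflexive; so there is at least one
   start. *)
have nx : a t0 <> b t0.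
  by move=> e; apply: (irrE (x := y)); rewrite -{1}(e : x = y).
have us_gt0 : 0 < size us.
  by have [s [/cova[i iu _] _ _]] := a_start_below ordE meetP nx; exact: leq_ltn_trans iu.
have [s sP] : exists s : seq bool, forall m, [/\ size s = size us + size us,
    size (positions false s m) = size us, size (positions true s m) = size us &
    forall i j, i < size us -> j < size us ->
      (lt (a (nth t0 us i)) (b (nth t0 us j)) /\ nth 0 (positions false s m) i < nth 0 (positions true s m) j) \/
      (lt (b (nth t0 us j)) (a (nth t0 us i)) /\ nth 0 (positions true s m) j < nth 0 (positions false s m) i)].
  have [|||s sP] := @interleaving (map a us) (map b us).
  - move=> d i j ij; rewrite size_map => ju; rewrite !(nth_map t0) //; last exact: ltn_trans ju.
    exact: inc.
  - move=> d i j ij; rewrite size_map => ju; rewrite !(nth_map t0) //; last exact: ltn_trans ju.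
    by apply/ordE; exact: inc.
  - move=> d i j; rewrite !size_map => iu ju; rewrite !(nth_map t0) // => e.
    by apply: (nsh j ju); exact: (meet_shared ordE meetP e).
  exists s => m; have := sP m; rewrite !size_map => -[h1 h2 h3 h4]; split=> // i j iu ju.
  by have := h4 x i j iu ju; rewrite !(nth_map t0).
have [ssz pf pt sP1] := sP 1.
have aE i : a_idx (size us) (pat s) i = nth 0 (positions false s 1) i.-1.
  rewrite /a_idx /positions ssz addnn -mul2n; congr nth; apply: eq_filter => j.
  by rewrite eqbF_neg subn1.
have bE i : b_idx (size us) (pat s) i = nth 0 (positions true s 1) i.-1.
  rewrite /b_idx /positions ssz addnn -mul2n; congr nth; apply: eq_filter => j.
  by rewrite eqb_id subn1.
have rng i : 1 <= i <= size us -> i.-1 < size us by case: i.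
(* The pattern of this edge: h_i is the i-th start, of either kind, evaluated at both ends. *)
pose p := (s, map F us).
have szp : size p.2 = size us by rewrite size_map.
apply: (DP p _ _ x y xy) => [||k|]; rewrite ?szp //.
- rewrite -{2}pf /positions size_filter ssz addnn -mul2n; apply: eq_count => j.
  by rewrite eqbF_neg subn1.
- exact: (kxy (inr (s, us, k))).
have hx i : 1 <= i <= size us -> ht p.2 i x = a (nth t0 us i.-1).
  by move=> /rng iu; rewrite /ht (nth_map_fun _ t0).
have hy i : 1 <= i <= size us -> ht p.2 i y = b (nth t0 us i.-1).
  by move=> /rng iu; rewrite /ht (nth_map_fun _ t0).
pose phi (k : nat) : T := GenTree.Node (pickle (s, 0, k)) us.
have phiE k z : (D p).1.2 k z = F (phi k) z by rewrite opE /op pickleK.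
have abpos i j : 1 <= i <= size us -> 1 <= j <= size us -> a_idx (size us) (pat s) i < b_idx (size us) (pat s) j ->
    lt (a (nth t0 us i.-1)) (b (nth t0 us j.-1)).
  move=> /rng iu /rng ju; rewrite aE bE => l.
  by have [[]|[_ l']] := sP1 _ _ iu ju => //; have := ltn_trans l l'; rewrite ltnn.
have bapos i j : 1 <= i <= size us -> 1 <= j <= size us -> b_idx (size us) (pat s) j < a_idx (size us) (pat s) i ->
    lt (b (nth t0 us j.-1)) (a (nth t0 us i.-1)).
  move=> /rng iu /rng ju; rewrite aE bE => l.
  by have [[_ l']|[]] := sP1 _ _ iu ju => //; have := ltn_trans l l'; rewrite ltnn.
have incb i j : i < j -> j < size us -> lt (b (nth t0 us i)) (b (nth t0 us j)).
  by move=> ij ju; apply/ordE; exact: inc.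
have nshC i : i < size us -> b (nth t0 us i) <> a (nth t0 us i) by move=> /nsh h /esym.
have [roota tighta] := starts_tight ordE meetP sharedW nsh inc cova.
have [_ tightb] := starts_tight ordEC meetPC sharedWC nshC incb covb.
split; rewrite ?szp.
- move=> i ir; rewrite hx // hy //; have iu := rng _ ir.
  pose cT (t : T) : T := GenTree.Node (pickle (s, 1, 0)) (t :: us).
  pose nT (t : T) : T := GenTree.Node (pickle (s, 2, 0)) (t :: us).
  pose mT : T := GenTree.Node (pickle (s, 3, 0)) us.
  have cE t z : F (cT t) z = C (D p).1.1 (F t z) by rewrite opE /op pickleK.
  have nE t z : F (nT t) z = N (D p).1.1 (F t z) by rewrite opE /op pickleK.
  have mE z : F mT z = M (D p).1.1 by rewrite opE /op pickleK.
  have [st|[_ st]] := usP _ iu.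
    apply: (start_closed ordE meetP sharedW (MP _) (CP _) (NP _) (cT := cT) (nT := nT) (mT := mT) _ _ _ st).
    + by move=> t; rewrite /a /b !cE.
    + by move=> t; rewrite /a /b !nE.
    + by rewrite /a /b !mE.
  apply/and_comm; apply: (start_closed ordEC meetPC sharedWC (MP _) (CP _) (NP _) (cT := cT) (nT := nT) (mT := mT)).
  + by move=> t; rewrite /a /b !cE.
  + by move=> t; rewrite /a /b !nE.
  + by rewrite /a /b !mE.
  split=> [|u nu uu]; first exact: nshC.
  by have [|w [nw l1 l2]] := st u _ uu; [move/esym | exists w; split=> // /esym].
- move=> i i1 iu; have ir : 1 <= i <= size us by rewrite i1 ltnW.
  rewrite !hx // !hy //; split; [apply: inc | apply: incb] => //; by rewrite prednK.
- by move=> i j ir jr l; rewrite hx // hy //; exact: abpos.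
- by move=> k; rewrite !phiE hx //; exact: (roota (phi k)).
- move=> k i j ir jr l; rewrite phiE hy // => h.
  apply: (tighta (phi k) _ _ (rng _ ir) (rng _ jr) (abpos _ _ ir jr l)).
  have [i1 _] := andP ir; rewrite prednK // => iu; by have := h iu; rewrite hx.
- move=> k i j ir jr l; rewrite phiE hx // => h.
  apply: (tightb (phi k) _ _ (rng _ jr) (rng _ ir) (bapos _ _ ir jr l)).
  have [j1 _] := andP jr; rewrite prednK // => ju; by have := h ju; rewrite hy.
Qed.

(** * The normal ideal of a pattern *)

Section GenericRealizations.
Variables (n : nat) (e : nat -> bool) (h : nat -> V -> V).
Hypothesis n_gt0 : 1 <= n.
Hypothesis card_e : count (fun j => ~~ e j) (iota 1 (2 * n)) = n.
Hypothesis generic : forall B Phi (kap : nat -> V -> L), exists x y,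
  [/\ E x y, forall k, kap k x = kap k y & generic_pair n e h B Phi x y].

(** Positivity for the ideal of sets destroyed by some choice of a club, countably many functions
    and colours. *)
Definition positive (A : V -> Prop) := forall B Phi (kap : nat -> V -> L), exists x y,
  [/\ A x, A y, E x y, forall k, kap k x = kap k y & generic_pair n e h B Phi x y].
Definition conull (R : V -> Prop) := ~ positive (fun x => ~ R x).

Lemma not_positive A : ~ positive A -> exists q : (V -> V) * (nat -> V -> V) * (nat -> V -> L),
  forall x y, A x -> A y -> E x y -> (forall k, q.2 k x = q.2 k y) -> ~ generic_pair n e h q.1.1 q.1.2 x y.
Proof.
move=> np; apply: contrapT => /forallNP no; apply: np => B Phi kap.
apply: contrapT => noE; apply: (no (B, Phi, kap)) => x y Ax Ay xy kxy gp.
by apply: noE; exists x, y.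
Qed.

(** Closure is compared only at the values of h, because a diagonal intersection gives it only above
    the parameters. *)
Lemma generic_pairW B B' Phi Phi' x y :
  (forall i, 1 <= i <= n -> closed_under B (h i x) -> closed_under B (h i y) ->
     closed_under B' (h i x) /\ closed_under B' (h i y)) ->
  (forall k, exists k', Phi' k x = Phi k' x /\ Phi' k y = Phi k' y) ->
  generic_pair n e h B Phi x y -> generic_pair n e h B' Phi' x y.
Proof.
move=> BB' PP' [cl inc l root tl tr]; split=> //.
- by move=> i ir; have [? ?] := cl i ir; exact: BB'.
- by move=> k; have [k' [e1 e2]] := PP' k; rewrite e1 e2; exact: root.
- by move=> k; have [k' [e1 _]] := PP' k; rewrite e1; exact: tl.
- by move=> k; have [k' [_ e2]] := PP' k; rewrite e2; exact: tr.
Qed.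

Lemma below_le v g g' : below v g -> ~ lt g' g -> below v g'.
Proof.
move=> bv gg' i iv; apply: lt_Nlt gg'; rewrite (set_nth_default g) //; exact: bv.
Qed.

Lemma pair_first B Phi x y i : generic_pair n e h B Phi x y -> 1 <= i <= n ->
  ~ lt (h i x) (h 1 x) /\ ~ lt (h i y) (h 1 y).
Proof.
move=> gp /andP[]; elim: i => // -[|i] IH _ iN; first by split; exact: lt_irr.
have [h1 h2] := IH isT (ltnW iN); have [l1 l2] := pair_incr gp (ltn0Sn i) iN.
by split=> l; [apply: h1 | apply: h2]; [exact: lt_trans l1 l | exact: lt_trans l2 l].
Qed.

(** Merges two countable families into one. *)
Definition mix (A : Type) (f g : nat -> A) (k : nat) := if odd k then f k./2 else g k./2.

Lemma mix_odd A (f g : nat -> A) k : mix f g k.*2.+1 = f k.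
Proof. by rewrite /mix /= odd_double uphalf_double. Qed.

Lemma mix_even A (f g : nat -> A) k : mix f g k.*2 = g k.
Proof. by rewrite /mix odd_double doubleK. Qed.

(* A bad v chosen for x has its entries below h 1 x, so by pair_root both ends of
   an edge choose the same v. *)
Lemma conull_normal (R : V -> Prop) (A : seq V -> V -> Prop) : conull R ->
  conull (fun x => R x /\ forall v, below v (h 1 x) -> A v x -> positive (A v)).
Proof.
move=> /not_positive[q0 q0P] pos.
have [i ii] := infL.
have /choice[q qP] : forall v, exists q : (V -> V) * (nat -> V -> V) * (nat -> V -> L),
    ~ positive (A v) -> forall x y, A v x -> A v y -> E x y -> (forall k, q.2 k x = q.2 k y) ->
    ~ generic_pair n e h q.1.1 q.1.2 x y.
  move=> v; have [pv|/not_positive[qv qvP]] := pselect (positive (A v)); last by exists qv.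
  by exists q0.
have /choice[w wP] : forall x, exists v, ~ (R x /\ forall v, below v (h 1 x) -> A v x -> positive (A v)) ->
    R x -> [/\ below v (h 1 x), A v x & ~ positive (A v)].
  move=> x; have [[Rx nx]|no] := pselect (R x /\ ~ forall v, below v (h 1 x) -> A v x -> positive (A v)).
    have [v /not_implyP[bv /not_implyP[Av npv]]] := (existsNP _).2 nx.
    by exists v.
  by exists [::] => nR Rx; case: no; split=> // al; apply: nR.
have [B1 B1P] := closed_under_diag (fun v => (q v).1.1).
have [B BP] := closed_under_meet q0.1.1 B1.
(* The data combine those destroying the complement of R with those destroying A (w x); the entries
   of w x are added as functions, its length and membership in R as colours. *)
have [x [y [nx ny xy kxy gp]]] := pos B
  (mix q0.1.2 (mix (fun k x => (q (w x)).1.2 k x) (fun k x => nth x (w x) k)))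
  (mix q0.2 (mix (fun k x => (q (w x)).2 k x) (fun k x => if k is 0 then i `[< R x >] else i (size (w x))))).
have eR : R x <-> R y.
  have := kxy 0.*2.*2; rewrite /mix /= => /ii; case: asboolP => h1; case: asboolP => h2 //; tauto.
have [Rx|nR] := pselect (R x); last first.
  apply: (q0P x y nR _ xy _ (generic_pairW _ _ gp)).
  - by rewrite -eR.
  - by move=> k; have := kxy k.*2.+1; rewrite mix_odd.
  - by move=> j _ /BP[? _] /BP[? _].
  - by move=> k; exists k.*2.+1; rewrite mix_odd.
have [bx Ax npx] := wP x nx Rx; have [by_ Ay _] := wP y ny (eR.1 Rx).
have ws : size (w x) = size (w y).
  by have := kxy 1.*2.*2; rewrite /mix /= => /ii.
have wE : w x = w y.
  apply: (eq_from_nth (x0 := h 1 x)) => // k kx.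
  have := pair_root gp (k := k.*2.*2); rewrite !mix_even.
  rewrite (set_nth_default (h 1 x) y) -?ws // (set_nth_default (h 1 x) x) // => ->//.
  exact: bx.
apply: (qP _ npx x y Ax _ xy _ (generic_pairW _ _ gp)); first by rewrite wE.
- by move=> k; have := kxy k.*2.+1.*2; rewrite mix_even mix_odd -wE.
(* The diagonal intersection applies because the entries of w x lie below h 1 x, hence below every h
   j x. *)
- move=> j jr /BP[_ /B1P c1] /BP[_ /B1P c2]; have [f1 f2] := pair_first gp jr.
  by split; [apply: c1; exact: below_le f1 | apply: c2; rewrite wE; exact: below_le f2].
- by move=> k; exists k.*2.+1.*2; rewrite mix_even mix_odd -wE.
Qed.

(** * Realizing structures in the graph *)

Hypothesis symE : forall x y, E x y -> E y x.

(** A colour telling membership in R puts both ends on the same side; outside R they contradict the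
    data destroying the complement. *)
Lemma conull_positive R : conull R -> positive R.
Proof.
move=> /not_positive[q qP] B Phi kap; have [i ii] := infL.
have [B' BP] := closed_under_meet q.1.1 B.
have [x [y [xy kxy gp]]] := generic B' (mix q.1.2 Phi) (mix q.2 (mix kap (fun _ x => i `[< R x >]))).
have eR : R x <-> R y.
  have := kxy 0; rewrite /mix /= => /ii; case: asboolP => h1; case: asboolP => h2 //; tauto.
have [Rx|nR] := pselect (R x); last first.
  case: (qP x y nR _ xy _ (generic_pairW _ _ gp)).
  - by rewrite -eR.
  - by move=> k; have := kxy k.*2.+1; rewrite mix_odd.
  - by move=> j _ /BP[? _] /BP[? _].
  - by move=> k; exists k.*2.+1; rewrite mix_odd.
exists x, y; split=> //; first exact/eR.
  by move=> k; have := kxy k.*2.+1.*2; rewrite mix_even mix_odd.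
apply: generic_pairW gp; first by move=> j _ /BP[_ ?] /BP[_ ?].
by move=> k; exists k.*2; rewrite mix_even.
Qed.

Lemma conull_true : conull (fun=> True).
Proof.
have [i _] := infL => pos.
by have [x [y [nx _ _ _ _]]] := pos id (fun=> id) (fun _ _ => i 0); exact: nx.
Qed.

(* u places the points of H in the order V and g picks the vertices; asking
   g k to lie below the later positions makes g on an initial segment of H a
   parameter bounded by the next position. *)
Record realizes (R : V -> Prop) (B : V -> V) (H : structure) (u g : 'I_(sz H) -> V) : Prop := Realizes {
  real_mono : forall k l : 'I_(sz H), k < l -> lt (u k) (u l) /\ lt (g k) (u l);
  real_closed : forall k, closed_under B (u k);
  real_in : forall k, k \in sU H -> R (g k);
  real_h : forall k i, k \in sU H -> 1 <= i <= n -> h i (g k) = u (sh H i k);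
  real_top : forall k, k \in sU H -> h n (g k) = u k;
  real_edge : forall k l, [set k; l] \in sX H -> E (g k) (g l) }.

Definition realizable H := forall R B, conull R -> exists u g, @realizes R B H u g.

Lemma realizesW (R R' : V -> Prop) B B' H u g : (forall x, R x -> R' x) ->
  (forall d, closed_under B d -> closed_under B' d) ->
  @realizes R B H u g -> realizes R' B' u g.
Proof.
move=> RR' BB' [mono cl inR hh top ed]; split=> // k; first by apply: BB'.
by move=> kU; apply: RR'; exact: inR.
Qed.

(** Common to both amalgamations: the copies coincide exactly below z, so realizations agreeing
    there glue once the order between the upper parts and the cross edges are checked. *)
Lemma amalgamate R B H H' (f0 f1 : 'I_(sz H) -> 'I_(sz H')) S0 S1 (z : 'I_(sz H)) u0 g0 u1 g1 :
  emb n H H' f0 S0 -> emb n H H' f1 S1 -> (forall v, v \in S0 \/ v \in S1) ->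
  (forall k : 'I_(sz H), k < z -> f0 k = f1 k) -> (forall k l : 'I_(sz H), f0 k = f1 l -> k < z) ->
  realizes R B u0 g0 -> realizes R B u1 g1 ->
  (forall k : 'I_(sz H), k < z -> u0 k = u1 k /\ g0 k = g1 k) ->
  (forall k l : 'I_(sz H), z <= k -> z <= l -> f0 k < f1 l -> lt (u0 k) (u1 l) /\ lt (g0 k) (u1 l)) ->
  (forall k l : 'I_(sz H), z <= k -> z <= l -> f1 l < f0 k -> lt (u1 l) (u0 k) /\ lt (g1 l) (u0 k)) ->
  (forall v w, [set v; w] \in sX H' -> (v \in S0 /\ w \in S0) \/ (v \in S1 /\ w \in S1) \/
     exists k l, E (g0 k) (g1 l) /\ (v = f0 k /\ w = f1 l \/ v = f1 l /\ w = f0 k)) ->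
  exists u g, @realizes R B H' u g.
Proof.
move=> [m0 [im0 [U0 [X0 h0]]]] [m1 [im1 [U1 [X1 h1]]]] cov fz zf r0 r1 agree c01 c10 edges.
have strict (f : 'I_(sz H) -> 'I_(sz H')) : (forall x y : 'I_(sz H), x < y -> f x < f y) ->
    forall k l : 'I_(sz H), f k < f l -> k < l.
  move=> mf k l fkl; case: (ltngtP k l) => // [/mf lk|/val_inj kl].
    by have := ltn_trans fkl lk; rewrite ltnn.
  by rewrite kl ltnn in fkl.
have inj (f : 'I_(sz H) -> 'I_(sz H')) : (forall x y : 'I_(sz H), x < y -> f x < f y) -> injective f.
  move=> mf k l fkl; apply: val_inj; case: (ltngtP k l) => // /mf; by rewrite fkl ltnn.
have /choice[P PP] : forall v, exists p : V * V,
    (exists k, v = f0 k /\ p = (u0 k, g0 k)) \/ (exists k, v = f1 k /\ p = (u1 k, g1 k)).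
  move=> v; case: (cov v) => [/im0[k <-]|/im1[k <-]].
    by exists (u0 k, g0 k); left; exists k.
  by exists (u1 k, g1 k); right; exists k.
have P0 k : P (f0 k) = (u0 k, g0 k).
  case: (PP (f0 k)) => -[l [e1 ->]]; first by rewrite (inj f0 m0 k l e1).
  have kz := zf _ _ e1; rewrite (fz k kz) in e1.
  by have [-> ->] := agree k kz; rewrite (inj f1 m1 k l e1).
have P1 l : P (f1 l) = (u1 l, g1 l).
  case: (PP (f1 l)) => -[k [e1 ->]]; last by rewrite (inj f1 m1 _ _ e1).
  have kz := zf _ _ (esym e1); rewrite (fz k kz) in e1.
  by have [-> ->] := agree k kz; rewrite (inj f1 m1 _ _ e1).
have all v : (exists k, v = f0 k) \/ (exists k, v = f1 k).
  by case: (cov v) => [/im0[k <-]|/im1[k <-]]; [left|right]; exists k.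
exists (fun v => (P v).1), (fun v => (P v).2); split.
- move=> v w; case: (all v) => -[k ->]; case: (all w) => -[l ->]; rewrite ?P0 ?P1 /= => vw.
  + by apply: (real_mono r0); exact: (strict f0 m0).
  + case: (ltnP k z) => kz.
      have [-> ->] := agree k kz; rewrite (fz k kz) in vw.
      by apply: (real_mono r1); exact: (strict f1 m1).
    case: (ltnP l z) => lz; last exact: c01.
    have [<- _] := agree l lz; rewrite -(fz l lz) in vw.
    by apply: (real_mono r0); exact: (strict f0 m0).
  + case: (ltnP k z) => kz.
      have [<- <-] := agree k kz; rewrite -(fz k kz) in vw.
      by apply: (real_mono r0); exact: (strict f0 m0).
    case: (ltnP l z) => lz; last exact: c10.
    have [-> _] := agree l lz; rewrite (fz l lz) in vw.
    by apply: (real_mono r1); exact: (strict f1 m1).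
  + by apply: (real_mono r1); exact: (strict f1 m1).
- by move=> v; case: (all v) => -[k ->]; rewrite ?P0 ?P1; [apply: (real_closed r0) | apply: (real_closed r1)].
- move=> v; case: (all v) => -[k ->]; rewrite ?U0 ?U1 ?P0 ?P1 => kU.
    exact: (real_in r0).
  exact: (real_in r1).
- move=> v i; case: (all v) => -[k ->]; rewrite ?U0 ?U1 => kU ir.
    by rewrite -h0 // !P0; exact: (real_h r0).
  by rewrite -h1 // !P1; exact: (real_h r1).
- move=> v; case: (all v) => -[k ->]; rewrite ?U0 ?U1 ?P0 ?P1 => kU.
    exact: (real_top r0).
  exact: (real_top r1).
- move=> v w vw; case: (edges _ _ vw) => [[/im0[k ek] /im0[l el]]|[[/im1[k ek] /im1[l el]]|[k [l [kl]]]]].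
  + by rewrite -ek -el X0 in vw; rewrite -ek -el !P0; exact: (real_edge r0).
  + by rewrite -ek -el X1 in vw; rewrite -ek -el !P1; exact: (real_edge r1).
  + by case=> -[-> ->]; rewrite P0 P1 //=; exact: symE.
Qed.

(** Both maps carry the points below z increasingly onto D, so by induction neither can skip a
    point. *)
Lemma common_initial_segment m m' (f0 f1 : 'I_m -> 'I_m') (D : {pred 'I_m'}) (z : 'I_m) :
  (forall x y : 'I_m, x < y -> f0 x < f0 y) -> (forall x y : 'I_m, x < y -> f1 x < f1 y) ->
  (forall k, (f0 k \in D) = (k < z)) -> (forall k, (f1 k \in D) = (k < z)) ->
  (forall v, v \in D -> exists k, f0 k = v) -> (forall v, v \in D -> exists k, f1 k = v) ->
  forall k : 'I_m, k < z -> f0 k = f1 k.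
Proof.
move=> m0 m1 D0 D1 im0 im1 k; have [N] := ubnP (val k); elim: N k => // N IH k /ltnSE kN kz.
have le (f g : 'I_m -> 'I_m') : (forall x y : 'I_m, x < y -> f x < f y) -> (forall x y : 'I_m, x < y -> g x < g y) ->
    (forall k, (f k \in D) = (k < z)) -> (forall k, (g k \in D) = (k < z)) ->
    (forall v, v \in D -> exists k, g k = v) -> (forall l : 'I_m, l < k -> f l = g l) -> g k <= f k.
  move=> mf mg Df Dg img agr; have [l el] : exists l, g l = f k by apply: img; rewrite Df.
  case: (ltngtP l k) => [lk|kl|lk]; last by rewrite -el (val_inj lk).
    by have := mf _ _ lk; rewrite agr // el ltnn.
  by rewrite -el ltnW // mg.
have agr (l : 'I_m) : l < k -> f0 l = f1 l.
  by move=> lk; apply: IH; [exact: leq_trans lk kN | exact: ltn_trans lk kz].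
apply: val_inj; apply/eqP; rewrite eqn_leq; apply/andP; split.
  by apply: (le f1 f0) => // l /agr.
exact: (le f0 f1).
Qed.

(** By [real_mono] this list lies below u z, so it can serve as a parameter for closure and
    normality at u z. *)
Definition initial_values (H : structure) (z : 'I_(sz H)) (u g : 'I_(sz H) -> V) : seq V :=
  map u [seq k : 'I_(sz H) <- enum 'I_(sz H) | k < z] ++ map g [seq k : 'I_(sz H) <- enum 'I_(sz H) | k < z].

Lemma initial_values_inj H z u g u' g' : @initial_values H z u g = initial_values z u' g' ->
  forall k : 'I_(sz H), k < z -> u k = u' k /\ g k = g' k.
Proof.
move=> /(congr1 (fun s : seq V => (take (size [seq k : 'I_(sz H) <- enum 'I_(sz H) | k < z]) s, drop (size [seq k : 'I_(sz H) <- enum 'I_(sz H) | k < z]) s))).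
rewrite /initial_values !take_size_cat ?size_map // !drop_size_cat ?size_map // => -[e1 e2] k kz.
have km : k \in [seq k : 'I_(sz H) <- enum 'I_(sz H) | k < z] by rewrite mem_filter kz mem_enum.
have aux (f f' : 'I_(sz H) -> V) s : map f s = map f' s -> k \in s -> f k = f' k.
  elim: s => // a s IH [ea es]; by rewrite in_cons => /predU1P[->|]; [exact: ea | exact: IH].
by split; [exact: aux e1 km | exact: aux e2 km].
Qed.

Lemma initial_values_below R B H z u g : @realizes R B H u g -> below (initial_values z u g) (u z).
Proof.
by move=> r; apply/below_cat; split; apply: below_map => k; rewrite mem_filter => /andP[kz _];
   have [] := real_mono r kz.
Qed.

(** One end x of a generic edge in R suffices: the values h_i(x) are the positions. *)
Lemma realizable_base H : iso_struct n (base_struct n) H -> realizable H.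
Proof.
move=> [f [mf [im [U [X fh]]]]] R B cR; have [i0 _] := infL.
have [x [y [Rx _ _ _ gp]]] := conull_positive cR B (fun=> id) (fun _ _ => i0 0).
have im' v : exists k, f k = v by apply/im; rewrite inE.
have inU k : (f k \in sU H) = (val k == n.-1) by rewrite U inE.
have inc (k l : 'I_n) : k < l -> lt (h k.+1 x) (h l.+1 x).
  have [m] := ubnP (val l); elim: m l => // m IH l /ltnSE lm kl.
  have l_gt0 : 0 < l by apply: leq_ltn_trans kl.
  have [step _] := pair_incr gp l_gt0 (ltn_ord l).
  have ln : l.-1 < n by apply: leq_ltn_trans (leq_pred _) (ltn_ord l).
  have [kl'|] := ltnP k l.-1; last first.
    by move=> lk; have -> : val k = l.-1; [apply/eqP; rewrite eqn_leq lk andbT -ltnS prednK | rewrite prednK].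
  have := IH (Ordinal ln) _ kl'; rewrite /= prednK // => IH'; apply: lt_trans (IH' _) step.
  exact: lm.
have /choice[p pP] : forall v, exists k, f k = v by [].
have pf k : p (f k) = k.
  apply: val_inj; have e1 := pP (f k).
  by case: (ltngtP (p (f k)) k) => // /mf; rewrite e1 ltnn.
have dom (v w : 'I_(sz H)) : v < w -> p v < p w.
  move=> vw; case: (ltngtP (p v) (p w)) => // [/mf|/val_inj e1]; rewrite ?pP.
    by move=> /(ltn_trans vw); rewrite ltnn.
  by move: vw; rewrite -(pP v) -(pP w) e1 ltnn.
(* Only the top point lies in U; for the others the position serves as a dummy vertex. *)
exists (fun v => h (p v).+1 x), (fun v => if val (p v) == n.-1 then x else h (p v).+1 x); split.
- move=> v w /dom pvw; rewrite ifN; first by split; exact: inc.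
  by rewrite neq_ltn -ltnS prednK // (leq_ltn_trans _ (ltn_ord (p w))) //=; case: ltngtP pvw.
- by move=> v; apply: (proj1 (pair_closed gp _)); rewrite /= ltn_ord.
- by move=> v; rewrite -{1}(pP v) inU => ->.
- move=> v i vU ir; have pU : val (p v) == n.-1 by rewrite -inU pP.
  have in1 : i.-1 < n by case: (i) ir => [|j] //.
  rewrite pU -{1}(pP v) -fh //; last by rewrite inE.
  by rewrite pf /= val_insubd in1 prednK //; case/andP: ir.
- move=> v vU; have pU : val (p v) == n.-1 by rewrite -inU pP.
  by rewrite pU (eqP pU) prednK.
- by move=> v w; rewrite -(pP v) -(pP w) X inE.
Qed.

Lemma eq_set2 (T : finType) (a b v w : T) : [set v; w] = [set a; b] ->
  (v = a /\ w = b) \/ (v = b /\ w = a).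
Proof.
move=> E0; have mem c : (c == v) || (c == w) = (c == a) || (c == b).
  by have := congr1 (fun A : {set T} => c \in A) E0; rewrite !inE.
have /esym := mem v; have /esym := mem w; have := mem a; have := mem b.
rewrite !eqxx !orbT /= => /orP hb /orP ha /orP hw /orP hv.
case: hv => /eqP ev; case: hw => /eqP ew; subst; auto.
  by case: hb => /eqP ->; auto.
by case: ha => /eqP ->; auto.
Qed.

(** If realizations over values w below x had bounded positions of x, a bound G w would depend on w
    alone, and positions closed under G exceed it. So the values w extend arbitrarily high, and the
    second copy goes above the first. *)
Lemma realizable_plus H x H' : realizable H -> is_plus n H x H' -> realizable H'.
Proof.
move=> rH [_ [blk [blk2 [blkm]]]] /= [f0 [f1 [em0 [em1 [[x0V x0min] [[x1V x1min] edges]]]]]] R B cR.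
pose ext w y := exists u g, [/\ @realizes R B H u g, initial_values x u g = w & ~ lt (u x) y].
have /choice[G GP] : forall w, exists b, (forall y, ext w y) \/ ~ ext w b.
  move=> w; have [al|/existsNP[b nb]] := pselect (forall y, ext w y).
    by have [v] := inhabited_V; exists v; left.
  by exists b; right.
have [B1 B1P] := closed_seq G; have [B' BP] := closed_under_meet B B1.
have [u [g r']] := rH R B' cR.
have r : realizes R B u g by apply: realizesW r' => // d /BP[].
pose w := initial_values x u g.
have unb : forall y, ext w y.
  case: (GP w) => // -[]; exists u, g; split=> //; apply: lt_asym.
  by apply: (B1P _ (BP _ (real_closed r' x)).2); exact: initial_values_below r.
have [b1 b1P] := bounded_nat (fun m => if insub m is Some k then u k else u x).
have [b2 b2P] := bounded_nat (fun m => if insub m is Some k then g k else u x).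
have [y [b1y b2y]] := bounded2 b1 b2.
have ub k : lt (u k) y /\ lt (g k) y.
  by split; [apply: lt_trans b1y; have := b1P k | apply: lt_trans b2y; have := b2P k]; rewrite valK.
have [u1 [g1 [r1 /esym/initial_values_inj agree uy]]] := unb y.
have [m0 [im0 _]] := em0; have [m1 [im1 _]] := em1.
have le_blk (v v' : 'I_(sz H')) : v <= v' -> blk v <= blk v'.
  by move=> vv; rewrite leqNgt; apply/negP => /blkm; rewrite ltnNge vv.
have bx0 : blk (f0 x) = 1 by move: x0V; rewrite inE => /eqP.
have bx1 : blk (f1 x) = 2 by move: x1V; rewrite inE => /eqP.
(* In either copy the common block W consists of the points below x. *)
have D0 k : (blk (f0 k) == 0) = (k < x).
  have : f0 k \in [set v | blk v != 2] by apply/im0; exists k.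
  rewrite inE => n2; apply/idP/idP => [/eqP b0|kx].
    rewrite ltnNge; apply/negP; rewrite leq_eqVlt => /predU1P[/val_inj e1|/m0 l].
      by move: b0; rewrite -e1 bx0.
    by have := le_blk _ _ (ltnW l); rewrite bx0 b0.
  have l := m0 _ _ kx; have := le_blk _ _ (ltnW l); rewrite bx0 leq_eqVlt ltnS leqn0 => /orP[b1'|//].
  by have := x0min (f0 k); rewrite inE b1' leqNgt l => /(_ isT).
have D1 k : (blk (f1 k) == 0) = (k < x).
  have : f1 k \in [set v | blk v != 1] by apply/im1; exists k.
  rewrite inE => n1; apply/idP/idP => [/eqP b0|kx].
    rewrite ltnNge; apply/negP; rewrite leq_eqVlt => /predU1P[/val_inj e1|/m1 l].
      by move: b0; rewrite -e1 bx1.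
    by have := le_blk _ _ (ltnW l); rewrite bx1 b0.
  have l := m1 _ _ kx; have := blk2 (f1 k); case eb: (blk (f1 k)) n1 => [|[|[|]]] // _ _.
  by have := x1min (f1 k); rewrite inE eb leqNgt l => /(_ isT).
have bk0 (k : 'I_(sz H)) : x <= k -> blk (f0 k) = 1.
  move=> xk; have : f0 k \in [set v | blk v != 2] by apply/im0; exists k.
  have := D0 k; rewrite ltnNge xk inE; have := blk2 (f0 k); by case: (blk _) => [|[|[|]]].
have bk1 (k : 'I_(sz H)) : x <= k -> blk (f1 k) = 2.
  move=> xk; have : f1 k \in [set v | blk v != 1] by apply/im1; exists k.
  have := D1 k; rewrite ltnNge xk inE; have := blk2 (f1 k); by case: (blk _) => [|[|[|]]].
apply: (amalgamate em0 em1 _ _ _ r r1 agree).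
- by move=> v; rewrite !inE; case: (blk v) => [|[|]]; [left|left|right].
- apply: (@common_initial_segment _ _ f0 f1 [pred v | blk v == 0] x m0 m1) => [k|k|v|v].
  + by rewrite inE D0.
  + by rewrite inE D1.
  + by rewrite inE => /eqP b0; apply/im0; rewrite inE b0.
  + by rewrite inE => /eqP b0; apply/im1; rewrite inE b0.
- move=> k l ekl; case: ltnP => // xk; have b0 := bk0 _ xk.
  have : f1 l \in [set v | blk v != 1] by apply/im1; exists l.
  by rewrite -ekl inE b0.
- move=> k l xk xl _; have ul : ~ lt (u1 l) (u1 x).
    case: (ltngtP x l) xl => // [xl _|/val_inj -> _]; last exact: lt_irr.
    by apply: lt_asym; have [] := real_mono r1 xl.
  have yl : ~ lt (u1 l) y.
    by move=> ly; apply: uy; apply: ltNlt ly.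
  by have [? ?] := ub k; split; apply: lt_Nlt yl.
- move=> k l xk xl lk; have := le_blk _ _ (ltnW lk); by rewrite bk0 // bk1.
- move=> v v' /edges[] /subsetP sub; [left | right; left]; split; apply: sub; rewrite !inE eqxx ?orbT //.
Qed.

(** * One-edge amalgamation *)

Definition block_idx (eps : bool) (i : nat) : nat :=
  nth 0 [seq j <- iota 1 (2 * n) | e j == eps] i.-1.

Lemma a_idxE i : a_idx n e i = block_idx false i.
Proof. by rewrite /a_idx /block_idx; congr nth; apply: eq_filter => j; rewrite eqbF_neg. Qed.

Lemma b_idxE i : b_idx n e i = block_idx true i.
Proof. by rewrite /b_idx /block_idx; congr nth; apply: eq_filter => j; rewrite eqb_id. Qed.

Lemma size_block_idx eps : size [seq j <- iota 1 (2 * n) | e j == eps] = n.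
Proof.
have f : count (fun j => e j == false) (iota 1 (2 * n)) = n.
  by rewrite -[RHS]card_e; apply: eq_count => j; rewrite eqbF_neg.
rewrite size_filter; case: eps => //.
apply: (@addnI n); rewrite -{1}f addnn -mul2n -[RHS](size_iota 1) -(count_predC (fun j => e j == false)).
by congr addn; apply: eq_count => j /=; case: (e j).
Qed.

Lemma block_idx_mem eps i : 1 <= i <= n -> 1 <= block_idx eps i <= 2 * n /\ e (block_idx eps i) = eps.
Proof.
move=> ir; have : block_idx eps i \in [seq j <- iota 1 (2 * n) | e j == eps].
  by apply: mem_nth; rewrite size_block_idx; case: i ir.
by rewrite mem_filter mem_iota add1n ltnS => /andP[/eqP].
Qed.

Lemma block_idx_onto j : 1 <= j <= 2 * n -> exists2 i, 1 <= i <= n & block_idx (e j) i = j.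
Proof.
move=> jr; have jm : j \in [seq k <- iota 1 (2 * n) | e k == e j].
  by rewrite mem_filter mem_iota eqxx add1n ltnS.
exists (index j [seq k <- iota 1 (2 * n) | e k == e j]).+1; last exact: nth_index.
by have := jm; rewrite -index_mem size_block_idx.
Qed.

Lemma block_idx_lt eps i j : 1 <= i -> i < j -> j <= n -> block_idx eps i < block_idx eps j.
Proof.
case: i j => [|i] [|j] // _ ij jn; apply: (sorted_ltn_nth ltn_trans) => //; rewrite ?inE ?size_block_idx //.
  by apply: sorted_filter; [exact: ltn_trans | exact: iota_ltn_sorted].
exact: ltn_trans jn.
Qed.

(** As h_i(y) starts the i-th block of its side, in H that block runs from h_i(y) up to
    h_{i+1}(y). *)
Lemma star_side H H' (y : 'I_(sz H)) (blk : 'I_(sz H') -> nat) eps f :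
  (forall v, blk v <= 2 * n) -> (forall u v, blk u < blk v -> u < v) -> y \in sU H ->
  emb n H H' f [set v | (blk v == 0) || ((1 <= blk v) && (e (blk v) == eps))] ->
  (forall i, 1 <= i <= n -> is_min (sh H' i (f y)) [set v | blk v == block_idx eps i]) ->
  (forall k : 'I_(sz H), (blk (f k) == 0) = (k < sh H 1 y)) /\
  (forall k : 'I_(sz H), sh H 1 y <= k -> exists i, [/\ 1 <= i <= n, blk (f k) = block_idx eps i,
     sh H i y <= k & i < n -> k < sh H i.+1 y]).
Proof.
move=> blkn blkm yU [mf [imf [_ [_ fh]]]] mins.
have min i : 1 <= i <= n -> blk (f (sh H i y)) = block_idx eps i /\
    forall v, blk v = block_idx eps i -> f (sh H i y) <= v.
  move=> ir; rewrite fh //; have [] := mins i ir; rewrite inE => /eqP bi lo; split=> // v bv.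
  by apply: lo; rewrite inE bv.
have strict (k l : 'I_(sz H)) : f k < f l -> k < l.
  move=> fkl; case: (ltngtP k l) => // [/mf lk|kl].
    by have := ltn_trans fkl lk; rewrite ltnn.
  by rewrite (val_inj kl) ltnn in fkl.
have idx k : blk (f k) != 0 -> exists2 i, 1 <= i <= n & blk (f k) = block_idx eps i.
  move=> b0; have : f k \in [set v | (blk v == 0) || ((1 <= blk v) && (e (blk v) == eps))].
    by apply/imf; exists k.
  rewrite inE (negPf b0) /= => /andP[b1 /eqP eb].
  by have [|i ir bi] := block_idx_onto (j := blk (f k)); [rewrite b1 blkn | exists i; rewrite // -bi eb].
have n1 : 1 <= 1 <= n by [].
have [b1 min1] := min 1 n1; have [/andP[pos1 _] _] := block_idx_mem eps n1.
have first (k : 'I_(sz H)) : (blk (f k) == 0) = (k < sh H 1 y).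
  apply/idP/idP => [/eqP b0|kz]; first by apply: strict; apply: blkm; rewrite b0 b1.
  apply: contraT => /idx[[|[|i]] // ir bi]; have l := mf _ _ kz.
    by have := min1 _ bi; rewrite leqNgt l.
  have : f (sh H 1 y) < f k by apply: blkm; rewrite b1 bi; apply: block_idx_lt => //; case/andP: ir.
  by move/(ltn_trans l); rewrite ltnn.
split=> // k zk; have [|i ir bi] := idx k; first by rewrite first -leqNgt.
exists i; split=> //.
  by have [_ /(_ _ bi) l] := min i ir; rewrite leqNgt; apply/negP => /mf; rewrite ltnNge l.
move=> iN; apply: strict; apply: blkm; rewrite bi (min i.+1 _).1; last by rewrite /= iN.
by apply: block_idx_lt => //; case/andP: ir.
Qed.

Lemma realizable_star H y H' : realizable H -> y \in sU H -> is_star n e H y H' -> realizable H'.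
Proof.
move=> rH yU [_ [blk [blkn [blkm]]]] /= [f0 [f1 [em0 [em1 [mins [_ edges]]]]]] R B cR.
pose z := sh H 1 y.
pose A v x := exists u g, [/\ @realizes R B H u g, initial_values z u g = v & g y = x].
have [u [g r']] := rH _ B (conull_normal (A := A) cR).
have r : realizes R B u g by apply: realizesW r' => // x [].
have [_ /(_ (initial_values z u g))] := real_in r' yU.
rewrite (real_h r' yU) // => /(_ (initial_values_below (z := z) r)) pA.
have {}pA : positive (A (initial_values z u g)) by apply: pA; exists u, g.
(* One realization is fixed for each vertex of A, so that its positions and vertices become
   functions, listed by [Phi]. *)
have /choice[p pP] : forall x, exists p : ('I_(sz H) -> V) * ('I_(sz H) -> V), A (initial_values z u g) x ->
    [/\ realizes R B p.1 p.2, initial_values z p.1 p.2 = initial_values z u g & p.2 y = x].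
  move=> x; have [[u' [g' r1]]|no] := pselect (A (initial_values z u g) x); first by exists (u', g').
  by exists (u, g).
pose Phi m x := match unpickle m : option (bool * 'I_(sz H)) with
  | Some (c, k) => if c then (p x).1 k else (p x).2 k | None => x end.
have PhiE c k x : Phi (pickle (c, k)) x = if c then (p x).1 k else (p x).2 k by rewrite /Phi pickleK.
have [i0 _] := infL.
(* The chosen realizations already have positions closed under B, so [id] is taken for the club. *)
have [x0 [x1 [/pP[r0 v0 gx0] /pP[r1 v1 gx1] x01 _ gp]]] := pA id Phi (fun _ _ => i0 0).
move: r0 r1 v0 v1 gx0 gx1 PhiE; set u0 := (p x0).1; set g0 := (p x0).2; set u1 := (p x1).1; set g1 := (p x1).2.
move=> r0 r1 v0 v1 gx0 gx1 PhiE.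
have agree := initial_values_inj (etrans v0 (esym v1)).
have [|first0 side0] := star_side blkn blkm yU em0; first by move=> i /mins[]; rewrite a_idxE.
have [|first1 side1] := star_side blkn blkm yU em1; first by move=> i /mins[]; rewrite b_idxE.
have [m0 [im0 _]] := em0; have [m1 [im1 _]] := em1.
have le_blk (v w : 'I_(sz H')) : v <= w -> blk v <= blk w.
  by move=> vw; rewrite leqNgt; apply/negP => /blkm; rewrite ltnNge vw.
have h0 i : 1 <= i <= n -> u0 (sh H i y) = h i x0 by move=> ir; rewrite -(real_h r0 yU ir) gx0.
have h1 i : 1 <= i <= n -> u1 (sh H i y) = h i x1 by move=> ir; rewrite -(real_h r1 yU ir) gx1.
have le_u w w' : realizes R B w w' -> forall k l : 'I_(sz H), k <= l -> ~ lt (w l) (w k).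
  move=> rw k l; rewrite leq_eqVlt => /predU1P[/val_inj ->|kl]; first exact: lt_irr.
  by apply: lt_asym; have [] := real_mono rw kl.
apply: (amalgamate em0 em1 _ _ _ r0 r1 agree).
- move=> v; rewrite !inE; case: (posnP (blk v)) => [b0|b0]; first by left.
  by case: (e (blk v)); [right|left].
- apply: (@common_initial_segment _ _ f0 f1 [pred v | blk v == 0] z m0 m1) => [k|k|v|v].
  + by rewrite inE first0.
  + by rewrite inE first1.
  + by rewrite inE => /eqP b0; apply/im0; rewrite inE b0.
  + by rewrite inE => /eqP b0; apply/im1; rewrite inE b0.
- move=> k l ekl; rewrite ltnNge; apply/negP => zk.
  have [i [ir bi _ _]] := side0 k zk; have [/andP[pi _] ei] := block_idx_mem false ir.
  have : f1 l \in [set v | (blk v == 0) || ((1 <= blk v) && (e (blk v) == true))] by apply/im1; exists l.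
  by rewrite -ekl inE bi ei andbF orbF eqn0Ngt pi.
- move=> k l zk zl kl; have [i [ir bi _ iN]] := side0 k zk; have [j [jr bj jl _]] := side1 l zl.
  have ij : a_idx n e i < b_idx n e j.
    rewrite a_idxE b_idxE; have := le_blk _ _ (ltnW kl); rewrite bi bj leq_eqVlt => /predU1P[eij|//].
    have [_ ei] := block_idx_mem false ir; have [_ ej] := block_idx_mem true jr.
    by rewrite eij ej in ei.
  (* A point k of block i lies below h_{i+1} of its end, so [pair_tightl] puts it below h_j of the
     other end, which is at most the position of l. *)
  have nl := le_u _ _ r1 _ _ jl; rewrite h1 // in nl.
  split; apply: lt_Nlt nl.
    have := pair_tightl (k := pickle (true, k)) gp ir jr ij; rewrite PhiE; apply=> iN'.
    by rewrite -h0 ?iN' // ; have [] := real_mono r0 (iN iN').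
  have := pair_tightl (k := pickle (false, k)) gp ir jr ij; rewrite PhiE; apply=> iN'.
  by rewrite -h0 ?iN' // ; have [] := real_mono r0 (iN iN').
- move=> k l zk zl lk; have [i [ir bi ik _]] := side0 k zk; have [j [jr bj _ jN]] := side1 l zl.
  have ji : b_idx n e j < a_idx n e i.
    rewrite a_idxE b_idxE; have := le_blk _ _ (ltnW lk); rewrite bi bj leq_eqVlt => /predU1P[eij|//].
    have [_ ei] := block_idx_mem false ir; have [_ ej] := block_idx_mem true jr.
    by rewrite -eij ej in ei.
  have nk := le_u _ _ r0 _ _ ik; rewrite h0 // in nk.
  split; apply: lt_Nlt nk.
    have := pair_tightr (k := pickle (true, l)) gp ir jr ji; rewrite PhiE; apply=> jN'.
    by rewrite -h1 ?jN' // ; have [] := real_mono r1 (jN jN').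
  have := pair_tightr (k := pickle (false, l)) gp ir jr ji; rewrite PhiE; apply=> jN'.
  by rewrite -h1 ?jN' // ; have [] := real_mono r1 (jN jN').
- move=> v w /edges[/subsetP sub|[/subsetP sub|/eq_set2 vw]].
  + by left; split; apply: sub; rewrite !inE eqxx ?orbT.
  + by right; left; split; apply: sub; rewrite !inE eqxx ?orbT.
  + by right; right; exists y, y; rewrite gx0 gx1; split.
Qed.

Lemma inK_realizable H : inK n e H -> realizable H.
Proof.
elim=> [H0|H0 x H1 _|H0 y H1 _]; [exact: realizable_base | exact: realizable_plus | exact: realizable_star].
Qed.

(** Vertices of U are distinct because h n recovers the position u k from g k. *)
Lemma inK_embeds H : inK n e H -> graph_embeds H E.
Proof.
move=> /inK_realizable rH; have [u [g r]] := rH _ id conull_true.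
exists g; split=> [k l kU lU gkl|]; last exact: (real_edge r).
have ukl : u k = u l by rewrite -(real_top r kU) gkl (real_top r lU).
by apply: val_inj; case: (ltngtP k l) => // /(real_mono r)[]; rewrite ukl => /lt_irr.
Qed.

End GenericRealizations.

End SuccessorCardinal.

Theorem theorem1 (L V : Type) (E : V -> V -> Prop) :
  card_le nat L ->                 (* lambda is infinite *)
  card_eq (nat -> L) L ->          (* lambda^aleph_0 = lambda *)
  is_succ_card L V ->              (* |G| = lambda^+ *)
  simple_graph E ->
  chromatic_number_is E V ->       (* Chr(G) = lambda^+ *)
  exists (n : nat) (e : nat -> bool),
    1 <= n /\ count (fun j => ~~ e j) (iota 1 (2 * n)) = n /\
    forall H : structure, inK n e H -> graph_embeds H E.
Proof.
move=> infL powL succV [symE irrE] [_ chrE].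
have [lt [wolt small]] := succ_card_wo infL powL succV.
have [[_ VL] minV] := succV.
(* By Cantor lambda < 2^lambda, hence lambda^+ is at most 2^lambda. *)
have powV : card_le V (L -> bool) by apply: minV; exact: card_lt_powerset.
have [n [e [h [n1 ce gen]]]] := generic_pattern infL powL VL wolt small powV irrE (chrE L succV.1).
by exists n, e; do 2!split=> //; move=> H; apply: (inK_embeds infL powL VL wolt small n1 ce gen symE).
Qed.
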